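(* Let $f:\mathbb{R}^2\to\mathbb{R}^2$ be an orientation preserving homeomorphism which satisfies the topological shadowing property. Then $f$ has a fixed point.
   Context: Let $(X,d)$ be a metric space and $f:X\to X$ a homeomorphism. Let $\mathcal{C}^+=\{\epsilon:X\to\mathbb{R}^+ : \epsilon \text{ continuous}\}$ (strictly positive continuous functions). For $\delta\in\mathcal{C}^+$, a sequence $\{x_n\}_{n\in\mathbb{Z}}\subset X$ is a $\delta$-pseudo-orbit of $f$ if $d(f(x_n),x_{n+1})<\delta(f(x_n))$ for every $n\in\mathbb{Z}$. For $\epsilon\in\mathcal{C}^+$, the sequence $\{x_n\}$ is $\epsilon$-shadowed by an orbit if there is $y\in X$ with $d(f^n(y),x_n)<\epsilon(x_n)$ for every $n\in\mathbb{Z}$. The homeomorphism $f$ satisfies the topological shadowing property if for every $\epsilon\in\mathcal{C}^+$ there exists $\delta\in\mathcal{C}^+$ such that every $\delta$-pseudo-orbit is $\epsilon$-shadowed by an orbit. On $\mathbb{R}^d$ the metric is the Euclidean one. *)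

(* Defs.v *)
From Stdlib Require Import Reals ZArith.
Open Scope R_scope.

Definition R2 : Type := (R * R)%type.

Definition dist2 (p q : R2) : R :=
  sqrt ((fst p - fst q) ^ 2 + (snd p - snd q) ^ 2).

Definition norm2 (p : R2) : R := sqrt (fst p ^ 2 + snd p ^ 2).

Definition cont2 (f : R2 -> R2) : Prop :=
  forall x eps, 0 < eps -> exists delta, 0 < delta /\
    forall y, dist2 y x < delta -> dist2 (f y) (f x) < eps.

Definition contR (e : R2 -> R) : Prop :=
  forall x eps, 0 < eps -> exists delta, 0 < delta /\
    forall y, dist2 y x < delta -> Rabs (e y - e x) < eps.

Definition Cplus (e : R2 -> R) : Prop := contR e /\ forall x, 0 < e x.

Definition homeo_with_inv (f g : R2 -> R2) : Prop :=
  cont2 f /\ cont2 g /\ (forall x, g (f x) = x) /\ (forall x, f (g x) = x).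

Definition iterZ (f g : R2 -> R2) (n : Z) (x : R2) : R2 :=
  match n with
  | Z0 => x
  | Zpos p => Nat.iter (Pos.to_nat p) f x
  | Zneg p => Nat.iter (Pos.to_nat p) g x
  end.

Definition pseudo_orbit (f : R2 -> R2) (delta : R2 -> R) (xs : Z -> R2) : Prop :=
  forall n : Z, dist2 (f (xs n)) (xs (n + 1)%Z) < delta (f (xs n)).

Definition shadowed (f g : R2 -> R2) (eps : R2 -> R) (xs : Z -> R2) : Prop :=
  exists y : R2, forall n : Z, dist2 (iterZ f g n y) (xs n) < eps (xs n).

Definition topological_shadowing (f g : R2 -> R2) : Prop :=
  forall eps, Cplus eps -> exists delta, Cplus delta /\
    forall xs, pseudo_orbit f delta xs -> shadowed f g eps xs.

(* Winding number of a loop gamma : [0,1] -> R^2 \ {c} around c equals 1: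
   a continuous angle function theta with gamma t - c = |gamma t - c| (cos theta t, sin theta t)
   on [0,1] increases by exactly 2*PI.  (Lifts are unique up to 2*k*PI, so this is well defined.) *)
Definition winding_one (gamma : R -> R2) (c : R2) : Prop :=
  exists theta : R -> R, continuity theta /\
    (forall t, 0 <= t <= 1 ->
       fst (gamma t) - fst c = norm2 (fst (gamma t) - fst c, snd (gamma t) - snd c) * cos (theta t) /\
       snd (gamma t) - snd c = norm2 (fst (gamma t) - fst c, snd (gamma t) - snd c) * sin (theta t)) /\
    theta 1 - theta 0 = 2 * PI.

Definition circle (x : R2) (r : R) (t : R) : R2 :=
  (fst x + r * cos (2 * PI * t), snd x + r * sin (2 * PI * t)).

(* orientation preserving: f maps every small positively oriented circle about x to a loop of
   winding number (local degree) +1 about f x *)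
Definition orientation_preserving (f : R2 -> R2) : Prop :=
  forall x r, 0 < r -> winding_one (fun t => f (circle x r t)) (f x).

(* Main.v *)
(** Assume that [f] has no fixed point.

    Every displacement [f x - x] then has a continuous angle [theta x] on the whole plane, and
    preservation of orientation gives a continuous rule [psi] for the angle of the chord from [f x]
    to [f y] in terms of the one from [x] to [y], which commutes with full turns and with the
    exchange of [x] and [y].  Suppose that a simple arc with [arc (t + 1) = f (arc t)] can be closed
    up by a path that is disjoint from its image.  Following the angle of the chord between two
    points of the arc and comparing it with [theta] by means of [psi] makes the two ends of the
    chord change places, so that an odd multiple of [2 * PI] vanishes.

    Such a closed curve exists as soon as some orbit has a cluster point: in the largest disc
    about [z] that is disjoint from its image there are boundary points [a] and [f a], and the
    images of the two radii from [a] to [z] to [f a] form an arc that returns to the disc.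
    Hence all orbits are unbounded in both directions.  (This is Brouwer's lemma.)

    Finally, unbounded orbits contradict shadowing.  Pick [q k] tending to a point [p], and
    [eps] so small at suitable far away points of the orbits that shadowing the forward orbit of
    [q k] forces the shadowing point to be [q k], and shadowing the backward orbit of [p] forces
    it to be [p].  Jumping from [p] to a close [q k] gives a pseudo-orbit that is not shadowed. *)

From Stdlib Require Import Reals ZArith Lra Lia Cantor ClassicalEpsilon.
From Coquelicot Require Import Coquelicot.
Require Import Defs.
Open Scope R_scope.

(** * Continuity on a subset *)

Lemma continuous_on_comp {U V W : UniformSpace} (D : U -> Prop) (E : V -> Prop)
    (g : U -> V) (f : V -> W) :
  continuous_on D g -> (forall x, D x -> E (g x)) -> continuous_on E f ->
  continuous_on D (fun x => f (g x)).
Proof.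
  intros Hg HDE Hf x Dx.
  apply (filterlim_comp _ _ _ g f _ (within E (locally (g x)))); [|now apply Hf, HDE].
  intros P HP. generalize (Hg x Dx _ HP). unfold filtermap, within.
  apply filter_imp. auto.
Qed.

Lemma continuous_on_comp_continuous {U V W : UniformSpace} (D : U -> Prop)
    (f : V -> W) (g : U -> V) :
  (forall x, continuous f x) -> continuous_on D g -> continuous_on D (fun x => f (g x)).
Proof.
  intros Hf Hg. apply (continuous_on_comp D (fun _ => True)); auto.
  now apply continuous_on_forall.
Qed.

Lemma continuous_on_id {U : UniformSpace} (D : U -> Prop) : continuous_on D (fun x : U => x).
Proof. apply continuous_on_forall; intros; apply continuous_id. Qed.

Lemma continuous_on_const {U V : UniformSpace} (D : U -> Prop) (v : V) :
  continuous_on D (fun _ : U => v).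
Proof. apply continuous_on_forall; intros; apply continuous_const. Qed.

Lemma continuous_on_pair {U V W : UniformSpace} (D : U -> Prop) (f : U -> V) (g : U -> W) :
  continuous_on D f -> continuous_on D g -> continuous_on D (fun x => (f x, g x)).
Proof.
  intros Hf Hg x Dx P [e He].
  apply (filterlim_pair f g (Hf x Dx) (Hg x Dx)).
  exists (ball (f x) e) (ball (g x) e); try apply locally_ball.
  intros u v Hu Hv. apply He. now split.
Qed.

Lemma continuous_on_fst {U V W : UniformSpace} (D : U -> Prop) (f : U -> V * W) :
  continuous_on D f -> continuous_on D (fun x => fst (f x)).
Proof. apply (continuous_on_comp_continuous D fst). intros [a b]; apply continuous_fst. Qed.

Lemma continuous_on_snd {U V W : UniformSpace} (D : U -> Prop) (f : U -> V * W) :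
  continuous_on D f -> continuous_on D (fun x => snd (f x)).
Proof. apply (continuous_on_comp_continuous D snd). intros [a b]; apply continuous_snd. Qed.

Lemma continuous_on_Rplus {U : UniformSpace} (D : U -> Prop) (f g : U -> R) :
  continuous_on D f -> continuous_on D g -> continuous_on D (fun x => f x + g x).
Proof.
  intros Hf Hg x Dx.
  exact (filterlim_comp_2 _ _ Rplus (Hf x Dx) (Hg x Dx) (filterlim_plus (V := R_NormedModule) _ _)).
Qed.

Lemma continuous_on_Rmult {U : UniformSpace} (D : U -> Prop) (f g : U -> R) :
  continuous_on D f -> continuous_on D g -> continuous_on D (fun x => f x * g x).
Proof.
  intros Hf Hg x Dx.
  exact (filterlim_comp_2 _ _ Rmult (Hf x Dx) (Hg x Dx) (filterlim_mult (K := R_AbsRing) _ _)).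
Qed.

Lemma continuous_on_Ropp {U : UniformSpace} (D : U -> Prop) (f : U -> R) :
  continuous_on D f -> continuous_on D (fun x => - f x).
Proof.
  apply (continuous_on_comp_continuous D Ropp).
  intros x; apply (filterlim_opp (V := R_NormedModule)).
Qed.

Lemma continuous_on_Rminus {U : UniformSpace} (D : U -> Prop) (f g : U -> R) :
  continuous_on D f -> continuous_on D g -> continuous_on D (fun x => f x - g x).
Proof. intros; apply continuous_on_Rplus; auto; now apply continuous_on_Ropp. Qed.

Lemma continuous_on_Rinv {U : UniformSpace} (D : U -> Prop) (f : U -> R) :
  continuous_on D f -> (forall x, D x -> f x <> 0) -> continuous_on D (fun x => / f x).
Proof.
  intros Hf Hf0. apply (continuous_on_comp D (fun y => y <> 0) f Rinv); auto.
  apply continuous_on_forall. apply continuous_Rinv.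
Qed.

#[local] Hint Resolve continuous_on_id continuous_on_const continuous_on_pair continuous_on_fst
  continuous_on_snd continuous_on_Rplus continuous_on_Rmult continuous_on_Ropp
  continuous_on_Rminus : continuity.

Lemma continuous_on_Cplus {U : UniformSpace} (D : U -> Prop) (f g : U -> C) :
  continuous_on D f -> continuous_on D g -> continuous_on D (fun x => (f x + g x)%C).
Proof. intros Hf Hg. apply continuous_on_pair; auto with continuity. Qed.

Lemma continuous_on_Copp {U : UniformSpace} (D : U -> Prop) (f : U -> C) :
  continuous_on D f -> continuous_on D (fun x => (- f x)%C).
Proof. intros Hf. apply continuous_on_pair; auto with continuity. Qed.

Lemma continuous_on_Cminus {U : UniformSpace} (D : U -> Prop) (f g : U -> C) :
  continuous_on D f -> continuous_on D g -> continuous_on D (fun x => (f x - g x)%C).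
Proof. intros Hf Hg. apply continuous_on_Cplus; auto. now apply continuous_on_Copp. Qed.

Lemma continuous_on_Cmult {U : UniformSpace} (D : U -> Prop) (f g : U -> C) :
  continuous_on D f -> continuous_on D g -> continuous_on D (fun x => (f x * g x)%C).
Proof. intros Hf Hg. apply continuous_on_pair; auto 6 with continuity. Qed.

Lemma continuous_on_RtoC {U : UniformSpace} (D : U -> Prop) (f : U -> R) :
  continuous_on D f -> continuous_on D (fun x => RtoC (f x)).
Proof. intros Hf. apply continuous_on_pair; auto with continuity. Qed.

#[local] Hint Resolve continuous_on_Cplus continuous_on_Cminus continuous_on_Cmult
  continuous_on_RtoC : continuity.

Lemma continuous_on_Cdiv {U : UniformSpace} (D : U -> Prop) (f g : U -> C) :
  continuous_on D f -> continuous_on D g -> (forall x, D x -> g x <> 0) ->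
  continuous_on D (fun x => (f x / g x)%C).
Proof.
  intros Hf Hg Hg0. apply continuous_on_Cmult; [exact Hf|].
  assert (Hinv : continuous_on D (fun x => / (fst (g x) ^ 2 + snd (g x) ^ 2))).
  { apply continuous_on_Rinv; [simpl; auto 8 with continuity|].
    intros x Dx E. apply (Hg0 x Dx). destruct (g x) as [u v]; simpl in E.
    apply injective_projections; simpl; nra. }
  apply continuous_on_pair; apply continuous_on_Rmult; auto with continuity.
Qed.

Lemma continuous_on_Cmod {U : UniformSpace} (D : U -> Prop) (f : U -> C) :
  continuous_on D f -> continuous_on D (fun x => Cmod (f x)).
Proof.
  intros Hf. apply (continuous_on_comp_continuous D sqrt); [apply continuous_sqrt|].
  simpl. auto 8 with continuity.
Qed.

Lemma continuous_on_dist2 {U : UniformSpace} (D : U -> Prop) (f g : U -> C) :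
  continuous_on D f -> continuous_on D g -> continuous_on D (fun x => dist2 (f x) (g x)).
Proof.
  intros Hf Hg. apply (continuous_on_Cmod D (fun x => f x - g x)%C); auto with continuity.
Qed.

Lemma continuous_on_Rmax {U : UniformSpace} (D : U -> Prop) (f g : U -> R) :
  continuous_on D f -> continuous_on D g -> continuous_on D (fun x => Rmax (f x) (g x)).
Proof.
  intros Hf Hg.
  apply (continuous_on_ext D (fun x => (f x + g x + Rabs (f x - g x)) * / 2)).
  - intros x _. unfold Rmax, Rabs. destruct Rle_dec, Rcase_abs; lra.
  - assert (continuous_on D (fun x => Rabs (f x - g x))); [|auto with continuity].
    apply (continuous_on_comp_continuous D Rabs); [apply continuous_Rabs | auto with continuity].
Qed.

Lemma continuous_on_Rmin {U : UniformSpace} (D : U -> Prop) (f g : U -> R) :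
  continuous_on D f -> continuous_on D g -> continuous_on D (fun x => Rmin (f x) (g x)).
Proof.
  intros Hf Hg. apply (continuous_on_ext D (fun x => - Rmax (- f x) (- g x))).
  - intros x _. now rewrite Rmax_opp_Rmin, Ropp_involutive.
  - apply continuous_on_Ropp, continuous_on_Rmax; auto with continuity.
Qed.

#[local] Hint Resolve continuous_on_Cmod continuous_on_dist2 continuous_on_Rmax
  continuous_on_Rmin : continuity.

Lemma continuous_of_continuous_on {U V : UniformSpace} (f : U -> V) :
  continuous_on (fun _ => True) f -> forall x, continuous f x.
Proof. intros Hf x. apply (continuous_continuous_on _ f x (filter_true) Hf). Qed.

Lemma ball_dist2 (x y : C) (e : R) : dist2 y x < e -> ball x e y.
Proof. exact (C_NormedModule_mixin_compat1 x y e). Qed.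

Lemma cont2_continuous (f : C -> C) : cont2 f -> forall x, continuous f x.
Proof.
  intros Hf x P [e He]. apply locally_C. destruct (Hf x e (cond_pos e)) as [d [Hd Hdf]].
  exists (mkposreal d Hd). intros y Hy. apply He, ball_dist2, Hdf, Hy.
Qed.

Lemma dist2_sym (p q : C) : dist2 p q = dist2 q p.
Proof. unfold dist2. f_equal; ring. Qed.

Lemma dist2_refl (p : C) : dist2 p p = 0.
Proof. unfold dist2. replace (_ + _) with 0 by ring. apply sqrt_0. Qed.

Lemma dist2_ge0 (p q : C) : 0 <= dist2 p q.
Proof. apply sqrt_pos. Qed.

Lemma dist2_Cmod (p q : C) : dist2 p q = Cmod (p - q).
Proof. reflexivity. Qed.

Lemma dist2_eq0 (p q : C) : dist2 p q = 0 -> p = q.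
Proof. intros H. apply Ceq_minus, Cmod_eq_0, H. Qed.

Lemma dist2_triangle (p q r : C) : dist2 p r <= dist2 p q + dist2 q r.
Proof.
  rewrite !dist2_Cmod. replace (p - r)%C with ((p - q) + (q - r))%C by ring.
  apply Cmod_triangle.
Qed.

(** * Arguments of nonzero complex numbers *)

Definition cis (t : R) : C := (cos t, sin t).

Definition is_arg (z : C) (t : R) : Prop := exists r, 0 < r /\ z = (r * cis t)%C.

Lemma cis_plus s t : cis (s + t) = (cis s * cis t)%C.
Proof. apply injective_projections; simpl; [rewrite cos_plus | rewrite sin_plus]; ring. Qed.

Lemma cis_0 : cis 0 = 1.
Proof. apply injective_projections; simpl; [apply cos_0 | apply sin_0]. Qed.

Lemma cis_PI : cis PI = (- (1))%C.
Proof. apply injective_projections; simpl; [apply cos_PI | rewrite sin_PI; ring]. Qed.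

Lemma Cmod_cis t : Cmod (cis t) = 1.
Proof.
  unfold Cmod, cis; simpl. rewrite !Rmult_1_r, Rplus_comm. fold (Rsqr (cos t)) (Rsqr (sin t)).
  rewrite sin2_cos2. apply sqrt_1.
Qed.

Lemma cis_neq0 t : cis t <> 0.
Proof. apply Cmod_gt_0. rewrite Cmod_cis. lra. Qed.

Lemma cis_inj s t : cis s = cis t -> exists k : Z, s = t + 2 * PI * IZR k.
Proof.
  intros E. injection E as Ecos Esin.
  assert (Ehalf : sin ((s - t) / 2) = 0).
  { assert (H : cos (2 * ((s - t) / 2)) = 1).
    { replace (2 * ((s - t) / 2)) with (s - t) by field.
      rewrite cos_minus, Ecos, Esin. assert (H := sin2_cos2 t). unfold Rsqr in H. lra. }
    rewrite cos_2a_sin in H. nra. }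
  destruct (sin_eq_0_0 _ Ehalf) as [k Hk]. exists k. lra.
Qed.

Lemma continuous_on_cis {U : UniformSpace} (D : U -> Prop) (f : U -> R) :
  continuous_on D f -> continuous_on D (fun x => cis (f x)).
Proof.
  intros Hf. apply continuous_on_pair.
  - apply (continuous_on_comp_continuous D cos); auto. apply continuous_cos.
  - apply (continuous_on_comp_continuous D sin); auto. apply continuous_sin.
Qed.

#[local] Hint Resolve continuous_on_cis : continuity.

Lemma is_arg_neq0 (z : C) t : is_arg z t -> z <> 0.
Proof.
  intros [r [Hr ->]]. apply Cmult_neq_0; [|apply cis_neq0].
  intros E. apply RtoC_inj in E. lra.
Qed.

Lemma is_arg_polar (z : C) t : is_arg z t -> z = (Cmod z * cis t)%C.
Proof.
  intros [r [Hr ->]]. rewrite Cmod_mult, Cmod_cis, Cmod_R, Rabs_pos_eq by lra.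
  now rewrite Rmult_1_r.
Qed.

Lemma polar_is_arg (z : C) t : z <> 0 -> z = (Cmod z * cis t)%C -> is_arg z t.
Proof. intros Hz E. exists (Cmod z). split; [now apply Cmod_gt_0 | exact E]. Qed.

Lemma is_arg_mult (z w : C) s t : is_arg z s -> is_arg w t -> is_arg (z * w) (s + t).
Proof.
  intros [r [Hr ->]] [q [Hq ->]]. exists (r * q). split; [now apply Rmult_lt_0_compat|].
  rewrite cis_plus, RtoC_mult. ring.
Qed.

Lemma is_arg_opp (z : C) t : is_arg z t -> is_arg (- z) (t + PI).
Proof.
  intros [r [Hr ->]]. exists r. split; [exact Hr|]. rewrite cis_plus, cis_PI. ring.
Qed.

Lemma is_arg_unique (z : C) s t : is_arg z s -> is_arg z t -> exists k : Z, s = t + 2 * PI * IZR k.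
Proof.
  intros Hs Ht. apply cis_inj.
  assert (Hcis : forall u, is_arg z u -> cis u = (z / Cmod z)%C).
  { intros u [r [Hr ->]]. rewrite Cmod_mult, Cmod_cis, Cmod_R, Rabs_pos_eq, Rmult_1_r by lra.
    field. intros E. apply RtoC_inj in E. lra. }
  now rewrite !Hcis.
Qed.

Lemma cis_period t (k : Z) : cis (t + 2 * PI * IZR k) = cis t.
Proof.
  assert (Hsin : sin (PI * IZR k) = 0) by (apply sin_eq_0_1; exists k; ring).
  assert (H1 : cis (2 * PI * IZR k) = 1).
  { rewrite Rmult_assoc. unfold cis. rewrite cos_2a_sin, sin_2a, Hsin.
    apply injective_projections; simpl; ring. }
  rewrite cis_plus, H1. ring.
Qed.

Lemma is_arg_period (z : C) t (k : Z) : is_arg z t -> is_arg z (t + 2 * PI * IZR k).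
Proof. intros [r [Hr ->]]. exists r. now rewrite cis_period. Qed.

(* The principal argument, on the right half-plane only. *)
Definition arg (z : C) : R := atan (Im z / Re z).

Lemma is_arg_arg (z : C) : 0 < Re z -> is_arg z (arg z).
Proof.
  intros Hz. set (q := Im z / Re z).
  assert (Hq : 0 < sqrt (1 + Rsqr q)) by (apply sqrt_lt_R0; assert (H := Rle_0_sqr q); lra).
  exists (Re z * sqrt (1 + Rsqr q)). split; [now apply Rmult_lt_0_compat|].
  unfold cis, arg. fold q. rewrite cos_atan, sin_atan.
  apply injective_projections; simpl; change (fst z) with (Re z); change (snd z) with (Im z).
  - field. lra.
  - unfold q at 2. field. lra.
Qed.

Lemma arg_div_diag (z : C) : z <> 0 -> arg (z / z) = 0.
Proof.
  intros Hz. replace (z / z)%C with (RtoC 1) by (field; exact Hz).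
  unfold arg, Rdiv; simpl. rewrite Rmult_0_l. apply atan_0.
Qed.

Lemma is_arg_exists (z : C) : z <> 0 -> exists t, is_arg z t.
Proof.
  intros Hz.
  assert (Hmul : forall (w u : C) s, is_arg w s -> 0 < Re u -> z = (w * u)%C ->
    exists t, is_arg z t).
  { intros w u s Hw Hu ->. exists (s + arg u).
    apply is_arg_mult; [exact Hw | now apply is_arg_arg]. }
  assert (Hcis : forall s, is_arg (cis s) s).
  { intros s. exists 1. split; [lra | ring]. }
  assert (HCi : cis (PI / 2) = Ci) by (unfold cis; now rewrite cos_PI2, sin_PI2).
  destruct (Rtotal_order (Re z) 0) as [Hre|[Hre|Hre]].
  - apply (Hmul _ (- z)%C _ (Hcis PI)); [simpl; unfold Re in Hre; lra | rewrite cis_PI; ring].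
  - assert (Him : Im z <> 0).
    { intros Him. apply Hz. now apply injective_projections. }
    destruct (Rdichotomy _ _ Him) as [Hneg|Hpos].
    + apply (Hmul _ (Ci * z)%C _ (is_arg_opp _ _ (Hcis (PI / 2)))).
      * simpl. unfold Im in Hneg. lra.
      * rewrite HCi. apply injective_projections; simpl; ring.
    + apply (Hmul _ (- (Ci * z))%C _ (Hcis (PI / 2))).
      * simpl. unfold Im in Hpos. lra.
      * rewrite HCi. apply injective_projections; simpl; ring.
  - apply (Hmul 1 z 0); [rewrite <- cis_0; apply Hcis | exact Hre | ring].
Qed.

Lemma Re_div_gt0 (z w : C) : Cmod (w - z) < Cmod z -> 0 < Re (w / z).
Proof.
  intros H.
  assert (Hz : z <> 0) by (apply Cmod_gt_0; assert (H' := Cmod_ge_0 (w - z)); lra).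
  assert (Hpos : 0 < Cmod z) by now apply Cmod_gt_0.
  assert (Hmod : Cmod (w / z - 1) < 1).
  { replace (w / z - 1)%C with ((w - z) / z)%C by (field; exact Hz).
    rewrite Cmod_div by exact Hz. now apply (Rdiv_lt_1 _ _ Hpos). }
  assert (Hre := re_le_Cmod (w / z - 1)). apply Rabs_le_between in Hre.
  change (Re (w / z - 1)) with (Re (w / z) - 1) in Hre. lra.
Qed.

Lemma is_arg_close (z w : C) t : Cmod (w - z) < Cmod z -> is_arg z t -> is_arg w (t + arg (w / z)).
Proof.
  intros H Ht. replace w with (z * (w / z))%C at 1 by (field; exact (is_arg_neq0 z t Ht)).
  apply is_arg_mult; [exact Ht | now apply is_arg_arg, Re_div_gt0].
Qed.

Lemma continuous_on_arg {U : UniformSpace} (D : U -> Prop) (f : U -> C) :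
  continuous_on D f -> (forall x, D x -> 0 < Re (f x)) -> continuous_on D (fun x => arg (f x)).
Proof.
  intros Hf Hpos. apply (continuous_on_comp_continuous D atan); [apply continuous_atan|].
  apply continuous_on_Rmult; [now apply continuous_on_snd|].
  apply continuous_on_Rinv; [now apply continuous_on_fst|].
  intros x Dx. now apply Rgt_not_eq, Hpos.
Qed.

Lemma continuous_on_arg_div {U : UniformSpace} (D : U -> Prop) (f g : U -> C) :
  continuous_on D f -> continuous_on D g -> (forall x, D x -> Cmod (f x - g x) < Cmod (g x)) ->
  continuous_on D (fun x => arg (f x / g x)).
Proof.
  intros Hf Hg H. apply continuous_on_arg.
  - apply continuous_on_Cdiv; auto. intros x Dx. apply Cmod_gt_0.
    assert (H' := Cmod_ge_0 (f x - g x)). specialize (H x Dx). lra.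
  - intros x Dx. now apply Re_div_gt0, H.
Qed.

(** * Continuous choices of arguments on convex sets *)

(* Convexity is only needed in finite products of copies of the line.  Going through
   [NormedModule] instead would make the domains carry product uniform structures that are
   convertible but not syntactically equal to the ones inferred everywhere else. *)
Class Segments (U : UniformSpace) := {
  segment : U -> U -> R -> U;
  segment_0 : forall x y, segment x y 0 = x;
  segment_1 : forall x y, segment x y 1 = y;
  continuous_segment : forall x p, continuous (fun p : U * R => segment x (fst p) (snd p)) p }.

#[refine] Instance R_Segments : Segments R_UniformSpace :=
  {| segment := fun x y t => x + t * (y - x) |}.
Proof.
  - intros x y; simpl; ring.
  - intros x y; simpl; ring.
  - intros x. apply continuous_of_continuous_on. auto with continuity.
Defined.

#[refine] Instance prod_Segments (U V : UniformSpace) `{Segments U} `{Segments V} :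
  Segments (prod_UniformSpace U V) :=
  {| segment := fun x y t => (segment (fst x) (fst y) t, segment (snd x) (snd y) t) |}.
Proof.
  - intros [x x'] y; simpl. now rewrite !segment_0.
  - intros x [y y']; simpl. now rewrite !segment_1.
  - intros x. apply continuous_of_continuous_on, continuous_on_pair.
    + apply (continuous_on_comp_continuous _ _ (fun p : U * V * R => (fst (fst p), snd p))
        (continuous_segment (fst x))); auto with continuity.
    + apply (continuous_on_comp_continuous _ _ (fun p : U * V * R => (snd (fst p), snd p))
        (continuous_segment (snd x))); auto with continuity.
Defined.

(* The low priority keeps this instance from being chosen for [R * R]. *)
Instance C_Segments : Segments C_UniformSpace | 10 :=
  prod_Segments R_UniformSpace R_UniformSpace.

Definition convex {U : UniformSpace} `{Segments U} (D : U -> Prop) : Prop :=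
  forall x y t, D x -> D y -> 0 <= t <= 1 -> D (segment x y t).

Definition affine {U : UniformSpace} `{Segments U} (l : U -> R) : Prop :=
  forall x y t, l (segment x y t) = segment (l x) (l y) t.

Section Convexity.

Context {U V : UniformSpace} `{Segments U} `{Segments V}.

Lemma affine_const (a : R) : affine (fun _ : U => a).
Proof. intros x y t; simpl; ring. Qed.

Lemma affine_fst : affine (fun p : R * U => fst p).
Proof. now intros x y t. Qed.

Lemma affine_snd : affine (fun p : U * R => snd p).
Proof. now intros x y t. Qed.

Lemma affine_minus (l m : U -> R) : affine l -> affine m -> affine (fun x => l x - m x).
Proof. intros Hl Hm x y t. rewrite Hl, Hm; simpl; ring. Qed.

Lemma convex_True : convex (fun _ : U => True).
Proof. now intros x y t. Qed.

Lemma convex_and (D E : U -> Prop) : convex D -> convex E -> convex (fun x => D x /\ E x).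
Proof. intros HD HE x y t [Dx Ex] [Dy Ey] Ht. split; auto. Qed.

Lemma convex_le (l m : U -> R) : affine l -> affine m -> convex (fun x => l x <= m x).
Proof. intros Hl Hm x y t Hx Hy Ht. rewrite Hl, Hm; simpl; nra. Qed.

Lemma convex_lt (l m : U -> R) : affine l -> affine m -> convex (fun x => l x < m x).
Proof.
  intros Hl Hm x y t Hx Hy Ht. rewrite Hl, Hm; simpl. destruct (Rle_lt_dec t (1 / 2)); nra.
Qed.

Lemma convex_snd (D : V -> Prop) : convex D -> convex (fun p : U * V => D (snd p)).
Proof. intros HD x y t. apply HD. Qed.

End Convexity.

Lemma affine_id : affine (fun x : R => x).
Proof. now intros x y t. Qed.

#[local] Hint Resolve affine_id affine_const affine_fst affine_snd affine_minus convex_True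
  convex_and convex_le convex_lt : convexity.

Definition clamp (t : R) : R := Rmax 0 (Rmin 1 t).

Lemma clamp_range t : 0 <= clamp t <= 1.
Proof. unfold clamp, Rmax, Rmin. repeat destruct Rle_dec; lra. Qed.

Lemma clamp_id t : 0 <= t <= 1 -> clamp t = t.
Proof. unfold clamp, Rmax, Rmin. repeat destruct Rle_dec; lra. Qed.

Lemma continuous_on_clamp {U : UniformSpace} (D : U -> Prop) (f : U -> R) :
  continuous_on D f -> continuous_on D (fun x => clamp (f x)).
Proof. intros Hf. unfold clamp. auto with continuity. Qed.

#[local] Hint Resolve continuous_on_clamp : continuity.

Lemma integer_valued_constant (h : R -> R) :
  (forall t, continuous h t) -> (forall t, exists k : Z, h t = IZR k) -> forall x y, h x = h y.
Proof.
  intros Hh Hint x y. destruct (Hint x) as [k Hk]. destruct (Hint y) as [l Hl].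
  destruct (Z.eq_dec k l) as [->|Hkl]; [now rewrite Hk, Hl|]. exfalso.
  assert (Hgap : IZR (Z.min k l) + 1 <= IZR (Z.max k l)).
  { rewrite <- plus_IZR. apply IZR_le. lia. }
  assert (Hmin : Rmin (h x) (h y) = IZR (Z.min k l)).
  { rewrite Hk, Hl. unfold Rmin. destruct Rle_dec as [H|H]; f_equal.
    - apply le_IZR in H. lia.
    - apply Rnot_le_lt, lt_IZR in H. lia. }
  assert (Hmax : Rmax (h x) (h y) = IZR (Z.max k l)).
  { rewrite Hk, Hl. unfold Rmax. destruct Rle_dec as [H|H]; f_equal.
    - apply le_IZR in H. lia.
    - apply Rnot_le_lt, lt_IZR in H. lia. }
  destruct (IVT_gen_consistent h x y (IZR (Z.min k l) + / 2) Hh) as [t [_ Ht]]; [lra|].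
  destruct (Hint t) as [m Hm]. rewrite Hm in Ht.
  assert (E : IZR (2 * m) = IZR (2 * Z.min k l + 1)) by (rewrite plus_IZR, !mult_IZR; lra).
  apply eq_IZR in E. lia.
Qed.

Lemma tube_lemma {U : UniformSpace} (x : U) (P : U -> R -> Prop) (a b : R) :
  (forall t, a <= t <= b -> locally (x, t) (fun p : U * R => P (fst p) (snd p))) ->
  locally x (fun y => forall t, a <= t <= b -> P y t).
Proof.
  intros HP.
  assert (Hloc : forall t0, exists d : posreal, a <= t0 <= b ->
    forall y t, ball x d y -> Rabs (t - t0) < d -> P y t).
  { intros t0. destruct (classic (a <= t0 <= b)) as [Ht0|]; [|now exists (mkposreal 1 Rlt_0_1)].
    destruct (HP t0 Ht0) as [d Hd]. exists d. intros _ y t Hy Ht. now apply (Hd (y, t)). }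
  apply choice in Hloc. destruct Hloc as [delta Hdelta].
  destruct (compactness_value_1d a b delta) as [d Hd].
  exists d. intros y Hy t Ht. apply NNPP. intros HnP.
  apply (Hd t Ht). intros [t0 [Ht0 [Htt0 Hdd]]].
  apply HnP, (Hdelta t0 Ht0); [now apply (ball_le x d) | exact Htt0].
Qed.

Lemma continuous_on_locally_gt0 {U : UniformSpace} (D : U -> Prop) (f : U -> R) (x : U) :
  continuous_on D f -> D x -> 0 < f x -> locally x (fun y => D y -> 0 < f y).
Proof. intros Hf Dx Hx. exact (Hf x Dx _ (open_gt 0 _ Hx)). Qed.

Lemma continuous_on_filterlim_within {U V : UniformSpace} (D E : U -> Prop) (f : U -> V) (x : U) :
  D x -> locally x (fun y => D y -> E y) -> continuous_on E f ->
  filterlim f (within D (locally x)) (locally (f x)).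
Proof.
  intros Dx HDE Hf P HP.
  generalize (filter_and _ _ HDE (Hf x (locally_singleton _ _ HDE Dx) P HP)).
  unfold filtermap, within. apply filter_imp. intros y [Hy HyP] Dy. auto.
Qed.

Lemma argument_difference_constant {U : UniformSpace} `{Segments U} (D : U -> Prop) (L M : U -> R) :
  convex D -> continuous_on D L -> continuous_on D M ->
  (forall x, D x -> exists k : Z, L x = M x + 2 * PI * IZR k) ->
  exists k : Z, forall x, D x -> L x = M x + 2 * PI * IZR k.
Proof.
  intros HD HL HM Hdiff.
  destruct (classic (exists x0, D x0)) as [[x0 Dx0]|Hempty].
  2:{ exists 0%Z. intros x Dx. elim Hempty. now exists x. }
  destruct (Hdiff x0 Dx0) as [k Hk]. exists k. intros x Dx.
  assert (P := PI_RGT_0).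
  set (path := fun t => segment x0 x (clamp t)).
  assert (Dpath : forall t, D (path t)) by (intros t; apply HD; auto; apply clamp_range).
  assert (Hpath : continuous_on (fun _ => True) path).
  { apply (continuous_on_comp_continuous _ _ (fun t => (x, clamp t)) (continuous_segment x0)).
    auto with continuity. }
  assert (E : (L (path 0) - M (path 0)) * / (2 * PI) = (L (path 1) - M (path 1)) * / (2 * PI)).
  { apply (integer_valued_constant (fun t => (L (path t) - M (path t)) * / (2 * PI))).
    - apply continuous_of_continuous_on, continuous_on_Rmult; [|auto with continuity].
      apply continuous_on_Rminus;
        [apply (continuous_on_comp _ D path L) | apply (continuous_on_comp _ D path M)]; auto.
    - intros t. destruct (Hdiff _ (Dpath t)) as [j Hj]. exists j. rewrite Hj. field. lra. }
  unfold path in E. rewrite !clamp_id, segment_0, segment_1, Hk in E by lra.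
  apply Rmult_eq_reg_r in E; [lra|]. apply Rinv_neq_0_compat. lra.
Qed.

Lemma path_argument_unique (z : R -> C) (L M : R -> R) :
  (forall t, continuous L t) -> (forall t, continuous M t) ->
  (forall t, 0 <= t <= 1 -> is_arg (z t) (L t)) -> (forall t, 0 <= t <= 1 -> is_arg (z t) (M t)) ->
  L 0 = M 0 -> L 1 = M 1.
Proof.
  intros HL HM AL AM E.
  destruct (argument_difference_constant (fun t => 0 <= t <= 1) L M) as [k Hk].
  - auto with convexity.
  - now apply continuous_on_forall.
  - now apply continuous_on_forall.
  - intros t Ht. apply (is_arg_unique (z t)); auto.
  - assert (E0 := Hk 0 ltac:(lra)). rewrite (Hk 1) by lra. lra.
Qed.

Lemma path_uniformly_close (z : R -> C) :
  (forall t, continuous z t) -> (forall t, z t <> 0) ->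
  exists d, 0 < d /\
    forall s t, 0 <= s <= 1 -> Rabs (t - s) < d -> Cmod (z t - z s) < Cmod (z s).
Proof.
  intros Hz Hz0.
  assert (Cz : forall (U : UniformSpace) (D : U -> Prop) (g : U -> R), continuous_on D g ->
    continuous_on D (fun x => z (g x))).
  { intros U D g. now apply continuous_on_comp_continuous. }
  assert (Hclose : locally 0 (fun r => forall s, 0 <= s <= 1 ->
    Cmod (z (s + r)%R - z s) < Cmod (z s))).
  { apply (tube_lemma 0 (fun r s => Cmod (z (s + r)%R - z s) < Cmod (z s))). intros s _.
    assert (Hgt0 : locally (0, s) (fun p : R * R => True ->
      0 < Cmod (z (snd p)) - Cmod (z (snd p + fst p)%R - z (snd p)))).
    { apply (continuous_on_locally_gt0 (fun _ : R * R => True)); cbn [fst snd];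
        auto 8 with continuity.
      replace (z (s + 0)%R - z s)%C with (RtoC 0) by (rewrite Rplus_0_r; ring).
      rewrite Cmod_0, Rminus_0_r. now apply Cmod_gt_0. }
    revert Hgt0. apply filter_imp. intros p Hp. now apply Rlt_0_minus, Hp. }
  destruct Hclose as [d Hd]. exists d. split; [apply cond_pos|]. intros s t Hs Hst.
  replace t with (s + (t - s)) by ring. apply Hd; [|exact Hs].
  change (Rabs (t - s + - 0) < d). now replace (t - s + - 0) with (t - s) by ring.
Qed.

Lemma path_argument_extend (z : R -> C) (L : R -> R) (a b : R) :
  (forall t, continuous z t) -> (forall t, continuous L t) -> 0 <= a <= b ->
  (forall t, 0 <= t <= a -> is_arg (z t) (L t)) ->
  (forall t, a <= t <= b -> Cmod (z t - z a) < Cmod (z a)) ->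
  exists L' : R -> R, (forall t, continuous L' t) /\ L' 0 = L 0 /\
    forall t, 0 <= t <= b -> is_arg (z t) (L' t).
Proof.
  intros Hz HL Hab AL Hclose.
  assert (Hza : z a <> 0) by (apply (is_arg_neq0 _ (L a)), AL; lra).
  set (proj := fun t => Rmax a (Rmin b t)).
  assert (Hproj : forall t, a <= proj t <= b).
  { intros t. unfold proj, Rmax, Rmin. repeat destruct Rle_dec; lra. }
  assert (Hleft : forall t, t <= a -> L (Rmin a t) + arg (z (proj t) / z a) = L t).
  { intros t Ht. unfold proj. rewrite !Rmin_right, Rmax_left, arg_div_diag by (auto; lra). ring. }
  exists (fun t => L (Rmin a t) + arg (z (proj t) / z a)). repeat split.
  - apply continuous_of_continuous_on, continuous_on_Rplus.
    + apply (continuous_on_comp_continuous _ L); auto with continuity.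
    + apply continuous_on_arg_div; auto with continuity.
      apply (continuous_on_comp_continuous _ z); unfold proj; auto with continuity.
  - apply Hleft. lra.
  - intros t Ht. destruct (Rle_lt_dec t a) as [Hta|Hta].
    + rewrite Hleft by exact Hta. apply AL. lra.
    + assert (Hpt : proj t = t) by (unfold proj; rewrite Rmin_right, Rmax_right; lra).
      rewrite Rmin_left, Hpt by lra. apply is_arg_close; [apply Hclose | apply AL]; lra.
Qed.

Lemma path_argument_exists (z : R -> C) (phi : R) :
  (forall t, continuous z t) -> (forall t, z t <> 0) -> is_arg (z 0) phi ->
  exists L : R -> R, (forall t, continuous L t) /\ L 0 = phi /\
    forall t, 0 <= t <= 1 -> is_arg (z t) (L t).
Proof.
  intros Hz Hz0 Hphi. destruct (path_uniformly_close z Hz Hz0) as [d [Hd Hclose]].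
  destruct (archimed_cor1 d Hd) as [N [HNd HN]]. apply lt_INR in HN; simpl in HN.
  assert (Hsteps : forall n, (n <= N)%nat -> exists L : R -> R, (forall t, continuous L t) /\
    L 0 = phi /\ forall t, 0 <= t <= INR n / INR N -> is_arg (z t) (L t)).
  { induction n as [|n IH]; intros Hn.
    - exists (fun _ => phi). repeat split; [intros; apply continuous_const|].
      intros t Ht. replace t with 0; [exact Hphi|]. simpl in Ht. lra.
    - destruct IH as [L [HL [HL0 AL]]]; [lia|].
      assert (HnN : 0 <= INR n / INR N /\ INR (S n) / INR N <= 1).
      { split; [apply Rdiv_le_0_compat; [apply pos_INR | exact HN]|].
        apply Rle_div_l; [exact HN|]. rewrite Rmult_1_l. now apply le_INR. }
      assert (Hnext : INR (S n) / INR N = INR n / INR N + / INR N) by (rewrite S_INR; field; lra).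
      assert (Hpos := Rinv_0_lt_compat _ HN).
      destruct (path_argument_extend z L (INR n / INR N) (INR (S n) / INR N))
        as [L' [HL' [HL'0 AL']]]; auto; [lra | | exists L'; now rewrite HL'0].
      intros t Ht. apply Hclose; [lra|]. apply Rabs_def1; lra. }
  destruct (Hsteps N (Nat.le_refl N)) as [L [HL [HL0 AL]]]. exists L. repeat split; auto.
  intros t Ht. apply AL. now rewrite Rdiv_diag by lra.
Qed.

Section ArgumentExists.

Context {U : UniformSpace} `{Segments U}.
Variables (D : U -> Prop) (F : U -> C) (x0 : U).
Hypothesis D_convex : convex D.
Hypothesis F_continuous : continuous_on D F.
Hypothesis F_neq0 : forall x, D x -> F x <> 0.
Hypothesis D_x0 : D x0.

Definition ray (x : U) (t : R) : C := F (segment x0 x (clamp t)).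

Lemma continuous_on_ray {V : UniformSpace} (E : V -> Prop) (g : V -> U) (h : V -> R) :
  continuous_on E g -> continuous_on E h -> (forall v, E v -> D (g v)) ->
  continuous_on E (fun v => ray (g v) (h v)).
Proof.
  intros Hg Hh HE. apply (continuous_on_comp E D (fun v => segment x0 (g v) (clamp (h v))) F).
  - apply (continuous_on_comp_continuous _ _ (fun v => (g v, clamp (h v))) (continuous_segment x0)).
    auto with continuity.
  - intros v Ev. apply D_convex; auto. apply clamp_range.
  - exact F_continuous.
Qed.

Lemma ray_0 x : ray x 0 = F x0.
Proof. unfold ray. rewrite clamp_id, segment_0; [reflexivity | lra]. Qed.

Lemma ray_1 x : ray x 1 = F x.
Proof. unfold ray. rewrite clamp_id, segment_1; [reflexivity | lra]. Qed.

Lemma ray_neq0 x t : D x -> ray x t <> 0.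
Proof. intros Dx. apply F_neq0, D_convex; auto. apply clamp_range. Qed.

Lemma rays_locally_close x : D x ->
  locally x (fun y => D y -> forall t, Cmod (ray y t - ray x t) < Cmod (ray x t)).
Proof.
  intros Dx.
  assert (Hclose : locally x (fun y => forall t, 0 <= t <= 1 -> D y ->
    Cmod (ray y t - ray x t) < Cmod (ray x t))).
  { apply (tube_lemma x (fun y t => D y -> Cmod (ray y t - ray x t) < Cmod (ray x t))). intros t _.
    assert (Hgt0 : locally (x, t) (fun p : U * R => D (fst p) ->
      0 < Cmod (ray x (snd p)) - Cmod (ray (fst p) (snd p) - ray x (snd p)))).
    { apply (continuous_on_locally_gt0 (fun p : U * R => D (fst p))); [|exact Dx|].
      - assert (Hx : continuous_on (fun p : U * R => D (fst p)) (fun p => ray x (snd p))).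
        { apply (continuous_on_ray _ (fun _ => x)); auto with continuity. }
        assert (Hy : continuous_on (fun p : U * R => D (fst p)) (fun p => ray (fst p) (snd p))).
        { apply continuous_on_ray; auto with continuity. }
        auto with continuity.
      - cbn [fst snd]. replace (ray x t - ray x t)%C with (RtoC 0) by ring.
        rewrite Cmod_0, Rminus_0_r. now apply Cmod_gt_0, ray_neq0. }
    revert Hgt0. apply filter_imp. intros p Hp Dp. now apply Rlt_0_minus, Hp. }
  revert Hclose. apply filter_imp. intros y Hy Dy t.
  assert (Hclamp := Hy (clamp t) (clamp_range t) Dy). unfold ray in *.
  now rewrite (clamp_id (clamp t) (clamp_range t)) in Hclamp.
Qed.

(* The argument at [x] is continued along the segment from [x0]; for [y] close to [x] the two
   continuations differ by the principal argument of [ray y t / ray x t]. *)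
Lemma argument_exists_nonempty : exists L : U -> R,
  continuous_on D L /\ forall x, D x -> is_arg (F x) (L x).
Proof.
  destruct (is_arg_exists _ (F_neq0 _ D_x0)) as [phi Hphi].
  assert (HL : forall x, exists L : R -> R, D x -> (forall t, continuous L t) /\ L 0 = phi /\
    forall t, 0 <= t <= 1 -> is_arg (ray x t) (L t)).
  { intros x. destruct (classic (D x)) as [Dx|]; [|now exists (fun _ => 0)].
    destruct (path_argument_exists (ray x) phi) as [L HL]; [| |now rewrite ray_0|now exists L].
    - apply continuous_of_continuous_on. apply continuous_on_ray; auto with continuity.
    - intros t. now apply ray_neq0. }
  apply choice in HL. destruct HL as [L HL].
  assert (Hlocal : forall x y, D x -> D y ->
    (forall t, Cmod (ray y t - ray x t) < Cmod (ray x t)) -> L x 1 + arg (F y / F x) = L y 1).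
  { intros x y Dx Dy Hclose. destruct (HL x Dx) as [Cx [Ex Ax]]. destruct (HL y Dy) as [Cy [Ey Ay]].
    rewrite <- (ray_1 x), <- (ray_1 y).
    apply (path_argument_unique (ray y) (fun t => L x t + arg (ray y t / ray x t))); auto.
    - apply continuous_of_continuous_on, continuous_on_Rplus; [now apply continuous_on_forall|].
      apply continuous_on_arg_div; auto; apply continuous_on_ray; auto with continuity.
    - intros t Ht. now apply is_arg_close, Ax.
    - rewrite Ex, Ey, !ray_0, arg_div_diag by auto. ring. }
  exists (fun x => L x 1). split.
  - intros x Dx.
    set (E := fun y => D y /\ forall t, Cmod (ray y t - ray x t) < Cmod (ray x t)).
    apply (continuous_on_filterlim_within D E (fun y => L y 1)); [exact Dx | |].
    + generalize (rays_locally_close x Dx). apply filter_imp. unfold E. auto.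
    + apply (continuous_on_ext E (fun y => L x 1 + arg (F y / F x))).
      { intros y [Dy Hy]. now apply Hlocal. }
      apply continuous_on_Rplus, continuous_on_arg_div; auto with continuity.
      * apply (continuous_on_subset D); [now intros y [] | exact F_continuous].
      * intros y [Dy Hy]. generalize (Hy 1). now rewrite !ray_1.
  - intros x Dx. rewrite <- ray_1. destruct (HL x Dx) as [_ [_ Ax]]. apply Ax. lra.
Qed.

End ArgumentExists.

Lemma argument_exists {U : UniformSpace} `{Segments U} (D : U -> Prop) (F : U -> C) :
  convex D -> continuous_on D F -> (forall x, D x -> F x <> 0) ->
  exists L : U -> R, continuous_on D L /\ forall x, D x -> is_arg (F x) (L x).
Proof.
  intros HD HF HF0. destruct (classic (exists x0, D x0)) as [[x0 Dx0]|Hempty].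
  - now apply (argument_exists_nonempty D F x0).
  - exists (fun _ => 0). split; intros x Dx; elim Hempty; now exists x.
Qed.

(** * Angles of moving chords *)

Record chord_angle {U : UniformSpace} (D : U -> Prop) (a b : U -> C) (tau : U -> R) : Prop := {
  chord_angle_start : continuous_on D a;
  chord_angle_end : continuous_on D b;
  chord_angle_continuous : continuous_on D tau;
  chord_angle_is_arg : forall x, D x -> is_arg (b x - a x) (tau x) }.

Arguments chord_angle_continuous {U D a b tau}.
Arguments chord_angle_is_arg {U D a b tau}.

Lemma chord_angle_exists {U : UniformSpace} `{Segments U} (D : U -> Prop) (a b : U -> C) :
  convex D -> continuous_on D a -> continuous_on D b -> (forall x, D x -> a x <> b x) ->
  exists tau, chord_angle D a b tau.
Proof.
  intros HD Ha Hb Hab. destruct (argument_exists D (fun x => b x - a x)%C) as [tau [Htau Atau]].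
  - exact HD.
  - auto with continuity.
  - intros x Dx. apply Cminus_eq_contra, not_eq_sym, Hab, Dx.
  - now exists tau.
Qed.

Lemma chord_angle_period {U : UniformSpace} (D : U -> Prop) (a b : U -> C) tau (k : Z) :
  chord_angle D a b tau -> chord_angle D a b (fun x => tau x + 2 * PI * IZR k).
Proof.
  intros [Ha Hb Htau Atau]. split; auto with continuity. intros x Dx. now apply is_arg_period, Atau.
Qed.

Lemma chord_angle_swap {U : UniformSpace} (D : U -> Prop) (a b : U -> C) tau :
  chord_angle D a b tau -> chord_angle D b a (fun x => tau x + PI).
Proof.
  intros [Ha Hb Htau Atau]. split; auto with continuity. intros x Dx.
  replace (a x - b x)%C with (- (b x - a x))%C by ring. now apply is_arg_opp, Atau.
Qed.

Lemma chord_angle_comp {U V : UniformSpace} (D : U -> Prop) {E : V -> Prop} (g : U -> V)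
    {a b : V -> C} {tau : V -> R} :
  chord_angle E a b tau -> continuous_on D g -> (forall x, D x -> E (g x)) ->
  chord_angle D (fun x => a (g x)) (fun x => b (g x)) (fun x => tau (g x)).
Proof.
  intros [Ha Hb Htau Atau] Hg HDE.
  split; [| | |now intros x Dx; apply Atau, HDE]; eapply continuous_on_comp; eauto.
Qed.

Lemma chord_angle_constant {U : UniformSpace} `{Segments U} (D : U -> Prop)
    (a b a' b' : U -> C) tau tau' :
  convex D -> chord_angle D a b tau -> chord_angle D a' b' tau' ->
  (forall x, D x -> (b x - a x = b' x - a' x)%C) ->
  exists k : Z, forall x, D x -> tau x = tau' x + 2 * PI * IZR k.
Proof.
  intros HD [_ _ Htau Atau] [_ _ Htau' Atau'] E. apply argument_difference_constant; auto.
  intros x Dx. apply (is_arg_unique (b x - a x)); [now apply Atau|].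
  rewrite E by exact Dx. now apply Atau'.
Qed.

Lemma chord_angle_unique {U : UniformSpace} `{Segments U} (D : U -> Prop)
    (a b a' b' : U -> C) tau tau' x0 :
  convex D -> chord_angle D a b tau -> chord_angle D a' b' tau' ->
  (forall x, D x -> (b x - a x = b' x - a' x)%C) -> D x0 -> tau x0 = tau' x0 ->
  forall x, D x -> tau x = tau' x.
Proof.
  intros HD Htau Htau' E Dx0 E0 x Dx.
  destruct (chord_angle_constant D a b a' b' tau tau' HD Htau Htau' E) as [k Hk].
  assert (Hk0 := Hk x0 Dx0). rewrite (Hk x Dx). lra.
Qed.

Lemma chord_angle_exists_from {U : UniformSpace} `{Segments U} (D : U -> Prop)
    (a b : U -> C) x0 t0 :
  convex D -> continuous_on D a -> continuous_on D b -> (forall x, D x -> a x <> b x) ->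
  D x0 -> is_arg (b x0 - a x0) t0 -> exists tau, chord_angle D a b tau /\ tau x0 = t0.
Proof.
  intros HD Ha Hb Hab Dx0 Ht0. destruct (chord_angle_exists D a b HD Ha Hb Hab) as [tau Htau].
  destruct (is_arg_unique _ _ _ Ht0 (chord_angle_is_arg Htau x0 Dx0)) as [k Hk].
  exists (fun x => tau x + 2 * PI * IZR k). split; [now apply chord_angle_period | now rewrite Hk].
Qed.

(** * Action of a homeomorphism on angles *)

Record angle_action (f : C -> C) (psi : C -> C -> R -> R) : Prop := {
  action_continuous : continuous_on (fun p : C * (C * R) => fst p <> fst (snd p))
    (fun p => psi (fst p) (fst (snd p)) (snd (snd p)));
  action_is_arg : forall x y t, is_arg (y - x) t -> is_arg (f y - f x) (psi x y t);
  action_period : forall x y t (k : Z), x <> y ->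
    psi x y (t + 2 * PI * IZR k) = psi x y t + 2 * PI * IZR k;
  action_swap : forall x y t, is_arg (y - x) t -> psi y x (t + PI) = psi x y t + PI }.

Arguments action_continuous {f psi}.
Arguments action_is_arg {f psi}.
Arguments action_period {f psi}.
Arguments action_swap {f psi}.

Lemma chord_angle_image {U : UniformSpace} (D : U -> Prop) (f : C -> C) psi (a b : U -> C) tau :
  (forall x, continuous f x) -> angle_action f psi -> chord_angle D a b tau ->
  chord_angle D (fun x => f (a x)) (fun x => f (b x)) (fun x => psi (a x) (b x) (tau x)).
Proof.
  intros Hf Hpsi [Ha Hb Htau Atau]. split.
  - now apply continuous_on_comp_continuous.
  - now apply continuous_on_comp_continuous.
  - apply (continuous_on_comp _ _ (fun x => (a x, (b x, tau x))))
      with (3 := action_continuous Hpsi); [auto with continuity|].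
    intros x Dx E. apply (is_arg_neq0 _ _ (Atau x Dx)). simpl in E. rewrite E. ring.
  - intros x Dx. now apply (action_is_arg Hpsi), Atau.
Qed.

Definition polar (x : C) (r t : R) : C := (x + r * cis t)%C.

Lemma polar_neq x r t : 0 < r -> x <> polar x r t.
Proof.
  intros Hr E. apply (is_arg_neq0 (polar x r t - x) t).
  - exists r. split; [exact Hr | unfold polar; ring].
  - rewrite <- E. ring.
Qed.

Lemma polar_of_is_arg (x y : C) t : is_arg (y - x) t -> polar x (Cmod (y - x)) t = y.
Proof. intros H. unfold polar. rewrite <- is_arg_polar by exact H. ring. Qed.

Lemma polar_half_turn x r t : polar (polar x r t) r (t + PI) = x.
Proof. unfold polar. rewrite cis_plus, cis_PI. ring. Qed.

Lemma continuous_on_polar {U : UniformSpace} (D : U -> Prop) (x : U -> C) (r t : U -> R) :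
  continuous_on D x -> continuous_on D r -> continuous_on D t ->
  continuous_on D (fun u => polar (x u) (r u) (t u)).
Proof. intros Hx Hr Ht. unfold polar. auto with continuity. Qed.

#[local] Hint Resolve continuous_on_polar : continuity.

Lemma circle_polar (x : C) r t : circle x r t = polar x r (2 * PI * t).
Proof. apply injective_projections; simpl; ring. Qed.

Definition polar_domain (p : C * (R * R)) : Prop := 0 < fst (snd p).

Definition polar_point (p : C * (R * R)) : C := polar (fst p) (fst (snd p)) (snd (snd p)).

Section AngleAction.

Variable f : C -> C.
Hypothesis f_continuous : forall x, continuous f x.
Hypothesis f_injective : forall x y, f x = f y -> x = y.
Hypothesis f_orientation : orientation_preserving f.

Lemma continuous_on_image {U : UniformSpace} (D : U -> Prop) (g : U -> C) :
  continuous_on D g -> continuous_on D (fun x => f (g x)).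
Proof. now apply continuous_on_comp_continuous. Qed.

Lemma polar_domain_convex : convex polar_domain.
Proof. apply (convex_snd (fun q : R * R => 0 < fst q)). auto with convexity. Qed.

Lemma polar_chord_angle_exists : exists polar_angle,
  chord_angle polar_domain (fun p => f (fst p)) (fun p => f (polar_point p)) polar_angle.
Proof.
  apply chord_angle_exists; [exact polar_domain_convex | | |].
  - apply continuous_on_image. auto with continuity.
  - apply continuous_on_image. unfold polar_point. auto with continuity.
  - intros p Hp E. apply f_injective in E. now apply polar_neq in E.
Qed.

Lemma image_circle_chord_angle (x : C) r : 0 < r -> exists theta,
  chord_angle (fun s => 0 <= s <= 1) (fun _ => f x) (fun s => f (polar x r (2 * PI * s))) theta /\
  theta 1 = theta 0 + 2 * PI.
Proof.
  intros Hr. destruct (f_orientation x r Hr) as [theta [Htheta [Hpolar Hturn]]].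
  exists theta. split; [|lra]. split.
  - auto with continuity.
  - apply continuous_on_image. auto with continuity.
  - apply continuous_on_forall. intros s _. apply continuity_pt_filterlim, Htheta.
  - intros s Hs. specialize (Hpolar s Hs). rewrite circle_polar in Hpolar.
    destruct Hpolar as [Hfst Hsnd]. apply polar_is_arg.
    + apply Cminus_eq_contra. intros E. apply f_injective in E. symmetry in E.
      now apply polar_neq in E.
    + apply injective_projections; simpl.
      * rewrite Rmult_0_l, Rminus_0_r. exact Hfst.
      * rewrite Rmult_0_l, Rplus_0_r. exact Hsnd.
Qed.

Variable polar_angle : C * (R * R) -> R.
Hypothesis polar_angle_chord :
  chord_angle polar_domain (fun p => f (fst p)) (fun p => f (polar_point p)) polar_angle.

Lemma polar_angle_full_turn x r t : 0 < r ->
  polar_angle (x, (r, t + 2 * PI)) = polar_angle (x, (r, t)) + 2 * PI.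
Proof.
  destruct (chord_angle_constant polar_domain
    (fun p => f (fst p)) (fun p => f (polar (fst p) (fst (snd p)) (snd (snd p) + 2 * PI)))
    (fun p => f (fst p)) (fun p => f (polar_point p))
    (fun p => polar_angle (fst p, (fst (snd p), snd (snd p) + 2 * PI))) polar_angle) as [k Hk].
  - exact polar_domain_convex.
  - apply (chord_angle_comp _ (fun p => (fst p, (fst (snd p), snd (snd p) + 2 * PI)))
      polar_angle_chord); auto 8 with continuity.
  - exact polar_angle_chord.
  - intros p _. unfold polar_point, polar.
    replace (2 * PI) with (2 * PI * IZR 1) by ring. now rewrite cis_period.
  - destruct (image_circle_chord_angle 0 1 Rlt_0_1) as [theta [Htheta Hturn]].
    destruct (chord_angle_constant (fun s => 0 <= s <= 1)
      (fun _ => f 0) (fun s => f (polar 0 1 (2 * PI * s)))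
      (fun _ => f 0) (fun s => f (polar 0 1 (2 * PI * s)))
      (fun s => polar_angle (RtoC 0, (1, 2 * PI * s))) theta) as [j Hj]; auto with convexity.
    + apply (chord_angle_comp _ (fun s => (RtoC 0, (1, 2 * PI * s))) polar_angle_chord).
      * auto with continuity.
      * intros s _. exact Rlt_0_1.
    + assert (E0 := Hj 0 ltac:(lra)). assert (E1 := Hj 1 ltac:(lra)).
      assert (E := Hk (RtoC 0, (1, 0)) Rlt_0_1).
      simpl in E. rewrite Rmult_0_r in E0. rewrite Rmult_1_r in E1. rewrite Rplus_0_l in E.
      intros Hr. specialize (Hk (x, (r, t)) Hr). simpl in Hk. rewrite Hk. lra.
Qed.

Lemma polar_angle_full_turns x r t (k : Z) : 0 < r ->
  polar_angle (x, (r, t + 2 * PI * IZR k)) = polar_angle (x, (r, t)) + 2 * PI * IZR k.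
Proof.
  intros Hr. revert k. apply Z.peano_ind.
  - now rewrite Rmult_0_r, !Rplus_0_r.
  - intros k IH. unfold Z.succ. rewrite plus_IZR.
    replace (t + 2 * PI * (IZR k + 1)) with (t + 2 * PI * IZR k + 2 * PI) by ring.
    rewrite polar_angle_full_turn, IH by exact Hr. ring.
  - intros k IH. unfold Z.pred. rewrite plus_IZR.
    assert (E := polar_angle_full_turn x r (t + 2 * PI * (IZR k + -1)) Hr).
    replace (t + 2 * PI * (IZR k + -1) + 2 * PI) with (t + 2 * PI * IZR k) in E by ring.
    lra.
Qed.

(* Exchanging the end points of a chord turns it by [PI]; applying this twice is a full turn, so
   the image chord is also turned by exactly [PI]. *)
Lemma polar_angle_half_turn x r t : 0 < r ->
  polar_angle (polar x r t, (r, t + PI)) = polar_angle (x, (r, t)) + PI.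
Proof.
  destruct (chord_angle_constant polar_domain
    (fun p => f (polar_point p))
    (fun p => f (polar (polar_point p) (fst (snd p)) (snd (snd p) + PI)))
    (fun p => f (polar_point p)) (fun p => f (fst p))
    (fun p => polar_angle (polar_point p, (fst (snd p), snd (snd p) + PI)))
    (fun p => polar_angle p + PI)) as [k Hk].
  - exact polar_domain_convex.
  - apply (chord_angle_comp _
      (fun p => (polar_point p, (fst (snd p), snd (snd p) + PI))) polar_angle_chord);
      unfold polar_point; auto 8 with continuity.
  - now apply chord_angle_swap.
  - intros p _. unfold polar_point. now rewrite polar_half_turn.
  - assert (Hstep : forall x r t, 0 < r ->
      polar_angle (polar x r t, (r, t + PI)) = polar_angle (x, (r, t)) + PI + 2 * PI * IZR k).
    { intros y s u Hs. exact (Hk (y, (s, u)) Hs). }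
    intros Hr. assert (Htwice := Hstep (polar x r t) r (t + PI) Hr).
    rewrite polar_half_turn, Hstep in Htwice by exact Hr.
    replace (t + PI + PI) with (t + 2 * PI) in Htwice by ring.
    rewrite polar_angle_full_turn in Htwice by exact Hr. rewrite Hstep by exact Hr. lra.
Qed.

Lemma polar_angle_action : angle_action f (fun x y t => polar_angle (x, (Cmod (y - x), t))).
Proof.
  assert (Hpos : forall x y : C, x <> y -> 0 < Cmod (y - x)).
  { intros x y H. now apply Cmod_gt_0, Cminus_eq_contra, not_eq_sym. }
  assert (Hneq : forall (x y : C) t, is_arg (y - x) t -> x <> y).
  { intros x y t H E. apply (is_arg_neq0 _ _ H). rewrite E. ring. }
  split.
  - apply (continuous_on_comp _ polar_domain
      (fun p : C * (C * R) => (fst p, (Cmod (fst (snd p) - fst p), snd (snd p)))) polar_angle).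
    + auto 8 with continuity.
    + intros p. apply Hpos.
    + apply (chord_angle_continuous polar_angle_chord).
  - intros x y t H.
    assert (A := chord_angle_is_arg polar_angle_chord (x, (Cmod (y - x), t))
      (Hpos x y (Hneq x y t H))).
    unfold polar_point in A; simpl in A. now rewrite polar_of_is_arg in A.
  - intros x y t k H. now apply polar_angle_full_turns, Hpos.
  - intros x y t H. assert (Hr := Hpos x y (Hneq x y t H)).
    assert (E := polar_angle_half_turn x (Cmod (y - x)) t Hr).
    rewrite polar_of_is_arg in E by exact H.
    rewrite <- E. do 3 f_equal. rewrite <- Cmod_opp. f_equal. ring.
Qed.

End AngleAction.

Lemma angle_action_exists (f : C -> C) :
  (forall x, continuous f x) -> (forall x y, f x = f y -> x = y) -> orientation_preserving f ->
  exists psi, angle_action f psi.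
Proof.
  intros Hf Hinj Hop. destruct (polar_chord_angle_exists f Hf Hinj) as [polar_angle Hpolar].
  exists (fun x y t => polar_angle (x, (Cmod (y - x), t))). now apply polar_angle_action.
Qed.

Lemma angle_action_turns (f : C -> C) psi (k : Z) :
  angle_action f psi -> angle_action f (fun x y t => psi x y t + 2 * PI * IZR k).
Proof.
  intros [Hcont Harg Hperiod Hswap]. split.
  - auto with continuity.
  - intros x y t H. now apply is_arg_period, Harg.
  - intros x y t j H. rewrite Hperiod by exact H. ring.
  - intros x y t H. rewrite Hswap by exact H. ring.
Qed.

Lemma compatible_angles_exist (f : C -> C) :
  (forall x, continuous f x) -> (forall x y, f x = f y -> x = y) -> orientation_preserving f ->
  (forall x, f x <> x) ->
  exists theta psi, chord_angle (fun _ => True) (fun x => x) f theta /\ angle_action f psi /\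
    forall x, theta (f x) = psi x (f x) (theta x).
Proof.
  intros Hf Hinj Hop Hfree. destruct (angle_action_exists f Hf Hinj Hop) as [psi Hpsi].
  assert (Cf : continuous_on (fun _ => True) f) by now apply continuous_on_forall.
  destruct (chord_angle_exists (fun _ : C => True) (fun x => x) f) as [theta Htheta];
    auto with convexity continuity.
  destruct (chord_angle_constant (fun _ : C => True) f (fun x => f (f x)) f (fun x => f (f x))
    (fun x => theta (f x)) (fun x => psi x (f x) (theta x))) as [k Hk]; auto with convexity.
  - now apply (chord_angle_comp _ f Htheta).
  - now apply chord_angle_image.
  - exists theta, (fun x y t => psi x y t + 2 * PI * IZR k). split; [exact Htheta|]. split.
    + now apply angle_action_turns.
    + intros x. now apply Hk.
Qed.

(** * Arcs closed up by a free path *)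

Section ClosingPath.

Variable f : C -> C.
Hypothesis f_continuous : forall x, continuous f x.
Hypothesis f_injective : forall x y, f x = f y -> x = y.
Hypothesis f_orientation : orientation_preserving f.

Variables (arc : R -> C) (M : R).
Hypothesis arc_continuous : forall t, continuous arc t.
Hypothesis arc_step : forall t, 0 <= t <= M - 1 -> arc (t + 1) = f (arc t).
Hypothesis arc_simple : forall s t, 0 <= s -> s < t -> t <= M -> t - s < M -> arc s <> arc t.
Hypothesis M_ge2 : 2 <= M.

Variables (closing : R -> C) (p : R).
Hypothesis closing_continuous : forall s, continuous closing s.
Hypothesis p_range : 0 <= p < M - 1.
Hypothesis closing_0 : closing 0 = arc M.
Hypothesis closing_1 : closing 1 = arc p.
Hypothesis closing_arc_disjoint : forall s t, 0 <= s <= 1 -> p < t < M -> closing s <> arc t.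
Hypothesis closing_free : forall s s', 0 <= s <= 1 -> 0 <= s' <= 1 -> f (closing s) <> closing s'.

Definition arc_pairs (st : R * R) : Prop :=
  0 <= fst st /\ fst st < snd st /\ snd st <= M /\ snd st - fst st < M.

Definition cross_pairs (ts : R * R) : Prop := p < fst ts < M /\ 0 <= snd ts <= 1.

Definition closing_pairs (ss : R * R) : Prop := 0 <= fst ss <= 1 /\ 0 <= snd ss <= 1.

Lemma continuous_on_arc {U : UniformSpace} (D : U -> Prop) (g : U -> R) :
  continuous_on D g -> continuous_on D (fun x => arc (g x)).
Proof. now apply continuous_on_comp_continuous. Qed.

Lemma continuous_on_closing {U : UniformSpace} (D : U -> Prop) (g : U -> R) :
  continuous_on D g -> continuous_on D (fun x => closing (g x)).
Proof. now apply continuous_on_comp_continuous. Qed.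

#[local] Hint Resolve continuous_on_image continuous_on_arc continuous_on_closing : continuity.

Section ChordAngles.

Variables (theta : C -> R) (psi : C -> C -> R -> R).
Hypothesis theta_chord : chord_angle (fun _ => True) (fun x => x) f theta.
Hypothesis psi_action : angle_action f psi.
Hypothesis theta_image : forall x, theta (f x) = psi x (f x) (theta x).

Variable arc_angle : R * R -> R.
Hypothesis arc_angle_chord :
  chord_angle arc_pairs (fun st => arc (fst st)) (fun st => arc (snd st)) arc_angle.
Hypothesis arc_angle_0_1 : arc_angle (0, 1) = theta (arc 0).

Lemma chord_angle_arc {U : UniformSpace} (D : U -> Prop) (g h : U -> R) :
  continuous_on D g -> continuous_on D h -> (forall x, D x -> arc_pairs (g x, h x)) ->
  chord_angle D (fun x => arc (g x)) (fun x => arc (h x)) (fun x => arc_angle (g x, h x)).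
Proof.
  intros Hg Hh HD. apply (chord_angle_comp D (fun x => (g x, h x)) arc_angle_chord);
    auto with continuity.
Qed.

Lemma arc_angle_step t : 0 <= t <= M - 1 -> arc_angle (t, t + 1) = theta (arc t).
Proof.
  revert t. apply (chord_angle_unique (fun t => 0 <= t <= M - 1)
    (fun t => arc t) (fun t => arc (t + 1)) (fun t => arc t) (fun t => f (arc t))
    (fun t => arc_angle (t, t + 1)) (fun t => theta (arc t)) 0).
  - auto with convexity.
  - apply chord_angle_arc; auto with continuity. unfold arc_pairs; simpl. intros t Ht. lra.
  - apply (chord_angle_comp _ arc theta_chord); auto with continuity.
  - intros t Ht. now rewrite arc_step.
  - lra.
  - now rewrite Rplus_0_l.
Qed.

Lemma arc_angle_image s t : 0 <= s -> s < t -> t <= M - 1 ->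
  arc_angle (s + 1, t + 1) = psi (arc s) (arc t) (arc_angle (s, t)).
Proof.
  intros Hs Hst Ht.
  apply (chord_angle_unique (fun st : R * R => 0 <= fst st /\ fst st < snd st /\ snd st <= M - 1)
    (fun st => arc (fst st + 1)) (fun st => arc (snd st + 1))
    (fun st => f (arc (fst st))) (fun st => f (arc (snd st)))
    (fun st => arc_angle (fst st + 1, snd st + 1))
    (fun st => psi (arc (fst st)) (arc (snd st)) (arc_angle (fst st, snd st))) (0, 1))
    with (x := (s, t)).
  - auto 6 with convexity.
  - apply chord_angle_arc; auto with continuity.
    unfold arc_pairs; simpl. intros [s' t'] H; simpl in *; lra.
  - apply chord_angle_image; auto. apply chord_angle_arc; auto with continuity.
    unfold arc_pairs; simpl. intros [s' t'] H; simpl in *; lra.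
  - intros [s' t'] H; simpl in *. now rewrite !arc_step by lra.
  - simpl; lra.
  - simpl. rewrite Rplus_0_l, arc_angle_0_1, arc_angle_step by lra.
    rewrite <- (Rplus_0_l 1), arc_step, theta_image by lra. reflexivity.
  - simpl; lra.
Qed.

Variable cross_angle : R * R -> R.
Hypothesis cross_angle_chord :
  chord_angle cross_pairs (fun ts => arc (fst ts)) (fun ts => closing (snd ts)) cross_angle.
Hypothesis cross_angle_base : cross_angle (p + 1, 0) = arc_angle (p + 1, M).

Lemma chord_angle_cross {U : UniformSpace} (D : U -> Prop) (g h : U -> R) :
  continuous_on D g -> continuous_on D h -> (forall x, D x -> cross_pairs (g x, h x)) ->
  chord_angle D (fun x => arc (g x)) (fun x => closing (h x)) (fun x => cross_angle (g x, h x)).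
Proof.
  intros Hg Hh HD. apply (chord_angle_comp D (fun x => (g x, h x)) cross_angle_chord);
    auto with continuity.
Qed.

Lemma cross_angle_start t : p < t < M -> cross_angle (t, 0) = arc_angle (t, M).
Proof.
  revert t. apply (chord_angle_unique (fun t => p < t < M)
    (fun t => arc t) (fun _ => closing 0) (fun t => arc t) (fun _ => arc M)
    (fun t => cross_angle (t, 0)) (fun t => arc_angle (t, M)) (p + 1)).
  - auto with convexity.
  - apply chord_angle_cross; auto with continuity.
    unfold cross_pairs; simpl. intros t Ht. lra.
  - apply chord_angle_arc; auto with continuity. unfold arc_pairs; simpl. intros t Ht. lra.
  - intros t Ht. now rewrite closing_0.
  - lra.
  - exact cross_angle_base.
Qed.

Lemma cross_angle_end : exists m : Z, forall t, p < t < M ->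
  cross_angle (t, 1) = arc_angle (p, t) + PI + 2 * PI * IZR m.
Proof.
  apply (chord_angle_constant (fun t => p < t < M)
    (fun t => arc t) (fun _ => closing 1) (fun t => arc t) (fun _ => arc p)
    (fun t => cross_angle (t, 1)) (fun t => arc_angle (p, t) + PI)).
  - auto with convexity.
  - apply chord_angle_cross; auto with continuity.
    unfold cross_pairs; simpl. intros t Ht. lra.
  - apply chord_angle_swap, chord_angle_arc; auto with continuity.
    unfold arc_pairs; simpl. intros t Ht. lra.
  - intros t Ht. now rewrite closing_1.
Qed.

Variable closing_angle : R * R -> R.
Hypothesis closing_angle_chord :
  chord_angle closing_pairs (fun ss => closing (snd ss)) (fun ss => f (closing (fst ss)))
    closing_angle.
Hypothesis closing_angle_0_0 : closing_angle (0, 0) = theta (closing 0).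

Lemma chord_angle_closing {U : UniformSpace} (D : U -> Prop) (g h : U -> R) :
  continuous_on D g -> continuous_on D h -> (forall x, D x -> closing_pairs (g x, h x)) ->
  chord_angle D (fun x => closing (h x)) (fun x => f (closing (g x)))
    (fun x => closing_angle (g x, h x)).
Proof.
  intros Hg Hh HD. apply (chord_angle_comp D (fun x => (g x, h x)) closing_angle_chord);
    auto with continuity.
Qed.

Lemma closing_angle_diagonal s : 0 <= s <= 1 -> closing_angle (s, s) = theta (closing s).
Proof.
  revert s. apply (chord_angle_unique (fun s => 0 <= s <= 1)
    (fun s => closing s) (fun s => f (closing s)) (fun s => closing s) (fun s => f (closing s))
    (fun s => closing_angle (s, s)) (fun s => theta (closing s)) 0).
  - auto with convexity.
  - apply chord_angle_closing; auto with continuity. now unfold closing_pairs.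
  - apply (chord_angle_comp _ closing theta_chord); auto with continuity.
  - reflexivity.
  - lra.
  - exact closing_angle_0_0.
Qed.

Lemma closing_angle_start s : 0 <= s <= 1 ->
  closing_angle (s, 0) = psi (arc (M - 1)) (closing s) (cross_angle (M - 1, s)).
Proof.
  assert (arc_M : arc M = f (arc (M - 1))) by (rewrite <- arc_step by lra; f_equal; ring).
  revert s. apply (chord_angle_unique (fun s => 0 <= s <= 1)
    (fun _ => closing 0) (fun s => f (closing s))
    (fun _ => f (arc (M - 1))) (fun s => f (closing s))
    (fun s => closing_angle (s, 0))
    (fun s => psi (arc (M - 1)) (closing s) (cross_angle (M - 1, s))) 0).
  - auto with convexity.
  - apply chord_angle_closing; auto with continuity.
    unfold closing_pairs; simpl. intros s Hs. lra.
  - apply chord_angle_image; auto. apply chord_angle_cross; auto with continuity.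
    unfold cross_pairs; simpl. intros s Hs. lra.
  - intros s Hs. now rewrite closing_0, arc_M.
  - lra.
  - change (closing_angle (0, 0) = psi (arc (M - 1)) (closing 0) (cross_angle (M - 1, 0))).
    rewrite closing_angle_0_0, cross_angle_start, closing_0 by lra.
    replace (arc_angle (M - 1, M)) with (theta (arc (M - 1))).
    + now rewrite arc_M, theta_image.
    + rewrite <- arc_angle_step by lra. do 2 f_equal. ring.
Qed.

Lemma cross_angle_image : exists m : Z, forall s, 0 <= s <= 1 ->
  cross_angle (p + 1, s) = closing_angle (1, s) + PI + 2 * PI * IZR m.
Proof.
  apply (chord_angle_constant (fun s => 0 <= s <= 1)
    (fun _ => arc (p + 1)) (fun s => closing s) (fun _ => f (closing 1)) (fun s => closing s)
    (fun s => cross_angle (p + 1, s)) (fun s => closing_angle (1, s) + PI)).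
  - auto with convexity.
  - apply chord_angle_cross; auto with continuity.
    unfold cross_pairs; simpl. intros s Hs. lra.
  - apply chord_angle_swap, chord_angle_closing; auto with continuity.
    unfold closing_pairs; simpl. intros s Hs. lra.
  - intros s Hs. now rewrite closing_1, arc_step by lra.
Qed.

(* If [c] is [closing_angle (1, 0)] and [b] is the angle of the image of the chord from [arc p] to
   [arc (M - 1)], then following the two ends of the closing path gives both
   [b = c + PI + 2 * PI * m] and [c = b + PI + 2 * PI * m]. *)
Lemma half_turns_contradict : False.
Proof.
  destruct cross_angle_end as [m Hm]. destruct cross_angle_image as [m' Hm'].
  set (a := arc_angle (p, M - 1)).
  assert (Ha : is_arg (arc (M - 1) - arc p) a).
  { apply (chord_angle_is_arg arc_angle_chord (p, M - 1)). unfold arc_pairs; simpl. lra. }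
  assert (Hends : arc (M - 1) <> arc p) by (apply not_eq_sym, arc_simple; lra).
  assert (Em : IZR m' = IZR m).
  { assert (E := Hm (p + 1) ltac:(lra)). assert (E' := Hm' 1 ltac:(lra)).
    rewrite arc_angle_step in E by lra. rewrite closing_angle_diagonal, closing_1 in E' by lra.
    assert (H := PI_RGT_0). nra. }
  assert (E0 : psi (arc p) (arc (M - 1)) a = closing_angle (1, 0) + PI + 2 * PI * IZR m).
  { assert (E := Hm' 0 ltac:(lra)). rewrite cross_angle_start, Em in E by lra. rewrite <- E.
    replace M with (M - 1 + 1) at 2 by ring. rewrite arc_angle_image by lra. reflexivity. }
  assert (E1 : closing_angle (1, 0) = psi (arc p) (arc (M - 1)) a + PI + 2 * PI * IZR m).
  { rewrite closing_angle_start, closing_1, Hm by lra.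
    rewrite (action_period psi_action), (action_swap psi_action) by assumption. reflexivity. }
  assert (E : IZR (1 + 2 * m) = 0).
  { rewrite plus_IZR, mult_IZR. assert (H := PI_RGT_0). nra. }
  apply eq_IZR in E. lia.
Qed.

End ChordAngles.

Lemma closing_path_fixed_point : exists x, f x = x.
Proof.
  apply NNPP. intros Hno.
  assert (Hfree : forall x, f x <> x) by (intros x E; apply Hno; now exists x).
  destruct (compatible_angles_exist f) as [theta [psi [Htheta [Hpsi Himage]]]]; auto.
  assert (Atheta : forall x, is_arg (f x - x) (theta x)).
  { intros x. now apply (chord_angle_is_arg Htheta). }
  destruct (chord_angle_exists_from arc_pairs (fun st => arc (fst st)) (fun st => arc (snd st))
    (0, 1) (theta (arc 0))) as [arc_angle [Harc Harc0]]; auto with continuity.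
  { unfold arc_pairs. auto 6 with convexity. }
  { intros [s t] H. unfold arc_pairs in H; simpl in *. apply arc_simple; lra. }
  { unfold arc_pairs; simpl; lra. }
  { simpl. rewrite <- (Rplus_0_l 1), arc_step by lra. apply Atheta. }
  destruct (chord_angle_exists_from cross_pairs
    (fun ts => arc (fst ts)) (fun ts => closing (snd ts)) (p + 1, 0) (arc_angle (p + 1, M)))
    as [cross_angle [Hcross Hcross0]]; auto with continuity.
  { unfold cross_pairs. auto 6 with convexity. }
  { intros [t s] H. unfold cross_pairs in H; simpl in *.
    apply not_eq_sym, closing_arc_disjoint; lra. }
  { unfold cross_pairs; simpl; lra. }
  { simpl. rewrite closing_0. apply (chord_angle_is_arg Harc (p + 1, M)).
    unfold arc_pairs; simpl; lra. }
  destruct (chord_angle_exists_from closing_pairs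
    (fun ss => closing (snd ss)) (fun ss => f (closing (fst ss))) (0, 0) (theta (closing 0)))
    as [closing_angle [Hclosing Hclosing0]]; auto with continuity.
  { unfold closing_pairs. auto 6 with convexity. }
  { intros [s s'] [Hs Hs']. now apply not_eq_sym, closing_free. }
  { unfold closing_pairs; simpl; lra. }
  now apply (half_turns_contradict theta psi Htheta Hpsi Himage arc_angle Harc Harc0
    cross_angle Hcross Hcross0 closing_angle).
Qed.

End ClosingPath.

(** * Cluster points and minima *)

Definition cluster_point {U : UniformSpace} (u : nat -> U) (y : U) : Prop :=
  forall (P : U -> Prop) (N : nat), locally y P -> exists n, (N <= n)%nat /\ P (u n).

Lemma bounded_sequence_cluster_R (u : nat -> R) (A : R) :
  (forall n, Rabs (u n) <= A) -> exists l : R, cluster_point u l.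
Proof.
  intros HA. destruct (Bolzano_Weierstrass u _ (compact_P3 (- A) A)) as [l Hl].
  - intros n. apply Rabs_le_between, HA.
  - exists l. intros P N [e He]. apply Hl. now exists e.
Qed.

Lemma inv_INR_small e : 0 < e -> exists N, forall n, (N <= n)%nat -> / (INR n + 1) < e.
Proof.
  intros He. destruct (archimed_cor1 e He) as [N [HN HN0]]. exists N. intros n Hn.
  apply Rle_lt_trans with (2 := HN). apply le_INR in Hn.
  apply Rinv_le_contravar; [now apply lt_0_INR | lra].
Qed.

Lemma cluster_point_subsequence (u : nat -> R) (l : R) : cluster_point u l ->
  exists phi, (forall k, (k <= phi k)%nat) /\ filterlim (fun k => u (phi k)) eventually (locally l).
Proof.
  intros Hl.
  assert (Hphi : forall k, exists n, (k <= n)%nat /\ ball l (/ (INR k + 1)) (u n)).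
  { intros k. apply Hl. exact (locally_ball l (mkposreal _ (RinvN_pos k))). }
  apply choice in Hphi. destruct Hphi as [phi Hphi]. exists phi. split; [apply Hphi|].
  intros P [e He]. destruct (inv_INR_small e (cond_pos e)) as [N HN]. exists N. intros k Hk.
  apply He, (ball_le l (/ (INR k + 1))); [now apply Rlt_le, HN | apply Hphi].
Qed.

Lemma bounded_sequence_cluster (u : nat -> C) (A : R) :
  (forall n, Cmod (u n) <= A) -> exists y : C, cluster_point u y.
Proof.
  intros HA.
  assert (Hmax : forall n, Rabs (fst (u n)) <= A /\ Rabs (snd (u n)) <= A).
  { intros n. assert (H := Rle_trans _ _ _ (Rmax_Cmod (u n)) (HA n)).
    split; eapply Rle_trans; try exact H; [apply Rmax_l | apply Rmax_r]. }
  destruct (bounded_sequence_cluster_R (fun n => fst (u n)) A) as [l Hl]; [apply Hmax|].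
  destruct (cluster_point_subsequence _ l Hl) as [phi [Hphi Hlim]].
  destruct (bounded_sequence_cluster_R (fun k => snd (u (phi k))) A) as [l' Hl'].
  { intros k. apply Hmax. }
  exists (l, l'). intros P N [e He].
  destruct (Hlim _ (locally_ball l e)) as [N' HN'].
  destruct (Hl' _ (N + N')%nat (locally_ball l' e)) as [k [Hk Hsnd]].
  exists (phi k). split; [specialize (Hphi k); lia|].
  apply He. split; [apply HN'; lia | exact Hsnd].
Qed.

Lemma coercive_minimum_exists (m : C -> R) (z : C) :
  (forall x, continuous m x) -> (forall x, dist2 x z <= m x) -> exists a, forall x, m a <= m x.
Proof.
  intros Hm Hz.
  destruct (completeness (fun y => exists x, y = - m x)) as [L [HL_ub HL_lub]].
  { exists 0. intros y [x ->]. assert (H := Hz x). assert (H' := dist2_ge0 x z). lra. }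
  { exists (- m z). now exists z. }
  assert (Hu : forall n, exists x, m x < - L + / (INR n + 1)).
  { intros n. apply NNPP. intros Hno. assert (P := RinvN_pos n).
    assert (L <= L - / (INR n + 1)); [|lra].
    apply HL_lub. intros y [x ->]. apply not_ex_all_not with (n := x) in Hno. lra. }
  apply choice in Hu. destruct Hu as [u Hu].
  destruct (bounded_sequence_cluster u (- L + 1 + Cmod z)) as [a Ha].
  { intros n. assert (H := Hz (u n)). specialize (Hu n).
    assert (Hinv : / (INR n + 1) <= 1).
    { rewrite <- Rinv_1. apply Rinv_le_contravar; [lra|]. assert (H' := pos_INR n). lra. }
    assert (T := Cmod_triangle (u n - z) z). replace (u n - z + z)%C with (u n) in T by ring.
    rewrite dist2_Cmod in H. lra. }
  exists a.
  assert (HaL : m a <= - L).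
  { apply Rnot_lt_le. intros Hlt.
    destruct (inv_INR_small ((m a + L) / 2)) as [N HN]; [lra|].
    destruct (Ha _ N (Hm a _ (open_gt (m a - (m a + L) / 2) (m a) ltac:(lra)))) as [n [Hn Hna]].
    specialize (HN n Hn). specialize (Hu n). lra. }
  intros x. assert (- m x <= L) by (apply HL_ub; now exists x). lra.
Qed.

(** * Maximal free discs *)

Definition radial (z : C) (s : R) (a : C) : C := (z + s * (a - z))%C.

Lemma dist2_radial z s a : dist2 (radial z s a) z = Rabs s * dist2 a z.
Proof. rewrite !dist2_Cmod, <- Cmod_R, <- Cmod_mult. unfold radial. f_equal. ring. Qed.

Lemma radial_0 z a : radial z 0 a = z.
Proof. unfold radial. ring. Qed.

Lemma radial_1 z a : radial z 1 a = a.
Proof. unfold radial. ring. Qed.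

Lemma radial_inj z s a b : 0 < s -> radial z s a = radial z s b -> a = b.
Proof.
  intros Hs E.
  assert (H : forall c, (c = z + (radial z s c - z) / s)%C).
  { intros c. unfold radial. field. intros Hs0. apply RtoC_inj in Hs0. lra. }
  rewrite (H a), (H b), E. reflexivity.
Qed.

Lemma continuous_on_radial {U : UniformSpace} (D : U -> Prop) (z : C) (s : U -> R) (a : C) :
  continuous_on D s -> continuous_on D (fun u => radial z (s u) a).
Proof. intros Hs. unfold radial. auto with continuity. Qed.

#[local] Hint Resolve continuous_on_radial : continuity.

Lemma bound_extends_to_closed_disc (phi : C -> R) z r : (forall x, continuous phi x) -> 0 < r ->
  (forall x, dist2 x z < r -> r <= phi x) -> forall x, dist2 x z <= r -> r <= phi x.
Proof.
  intros Hphi Hr Hopen x Hx. apply Rnot_lt_le. intros Hlt.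
  assert (Hray : continuous (fun s => phi (radial z s x)) 1).
  { apply continuous_of_continuous_on, (continuous_on_comp_continuous _ phi);
      auto with continuity. }
  assert (Hnear : locally 1 (fun s => phi (radial z s x) < r)).
  { apply (Hray (fun y => y < r)), open_lt. now rewrite radial_1. }
  destruct Hnear as [e He]. assert (Pe := cond_pos e).
  set (s := Rmax (1 / 2) (1 - e / 2)).
  assert (Hs : 1 - e / 2 <= s /\ 0 < s < 1).
  { unfold s, Rmax. destruct Rle_dec; lra. }
  assert (Hclose : phi (radial z s x) < r).
  { apply He. change (Rabs (s + - 1) < e). apply Rabs_def1; lra. }
  assert (Hfar : r <= phi (radial z s x)); [|lra].
  apply Hopen. rewrite dist2_radial, Rabs_pos_eq by lra.
  assert (H := dist2_ge0 x z). nra.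
Qed.

(* A disc is free when it is disjoint from its image; maximality is witnessed by a boundary point
   whose image is on the boundary as well. *)
Record maximal_free_disc (f : C -> C) (z : C) (r : R) (a : C) : Prop := {
  disc_radius_gt0 : 0 < r;
  disc_point : dist2 a z = r;
  disc_image : dist2 (f a) z = r;
  disc_open_free : forall x, dist2 x z < r -> r < dist2 (f x) z;
  disc_closed_free : forall x, dist2 x z <= r -> r <= dist2 (f x) z }.

Arguments disc_radius_gt0 {f z r a}.
Arguments disc_point {f z r a}.
Arguments disc_image {f z r a}.
Arguments disc_open_free {f z r a}.
Arguments disc_closed_free {f z r a}.

Lemma maximal_free_disc_exists (f g : C -> C) z :
  (forall x, continuous f x) -> (forall x, continuous g x) ->
  (forall x, g (f x) = x) -> (forall x, f (g x) = x) -> (forall x, f x <> x) ->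
  exists r a, maximal_free_disc f z r a.
Proof.
  intros Hf Hg Hgf Hfg Hfree.
  assert (Hdist : forall h : C -> C, (forall x, continuous h x) ->
    continuous_on (fun _ => True) (fun x => dist2 (h x) z)).
  { intros h Hh. apply continuous_on_dist2; auto with continuity. now apply continuous_on_forall. }
  destruct (coercive_minimum_exists (fun x => Rmax (dist2 x z) (dist2 (f x) z)) z) as [a Ha].
  { apply continuous_of_continuous_on, continuous_on_Rmax;
      [auto with continuity | now apply Hdist]. }
  { intros x; apply Rmax_l. }
  set (r := Rmax (dist2 a z) (dist2 (f a) z)) in Ha.
  assert (Hmax : dist2 a z <= r /\ dist2 (f a) z <= r) by (split; [apply Rmax_l | apply Rmax_r]).
  assert (Hr : 0 < r).
  { assert (H := dist2_ge0 a z). assert (H' := dist2_ge0 (f a) z).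
    destruct (Rle_lt_or_eq_dec 0 r) as [|E]; [lra | assumption |].
    elim (Hfree a). transitivity z; [|symmetry]; apply dist2_eq0; lra. }
  assert (Hopen : forall x, dist2 x z < r -> r <= dist2 (f x) z).
  { intros x Hx. specialize (Ha x). unfold Rmax in Ha at 1. destruct Rle_dec in Ha; lra. }
  assert (Hopen' : forall x, dist2 x z < r -> r <= dist2 (g x) z).
  { intros x Hx. specialize (Ha (g x)). rewrite Hfg in Ha. unfold Rmax in Ha at 1.
    destruct Rle_dec in Ha; lra. }
  assert (Hclosed := bound_extends_to_closed_disc _ z r
    (continuous_of_continuous_on _ (Hdist f Hf)) Hr Hopen).
  assert (Hclosed' := bound_extends_to_closed_disc _ z r
    (continuous_of_continuous_on _ (Hdist g Hg)) Hr Hopen').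
  assert (Hstrict : forall x, dist2 x z < r -> r < dist2 (f x) z).
  { intros x Hx. apply Rnot_le_lt. intros Hle. apply Hclosed' in Hle. rewrite Hgf in Hle. lra. }
  assert (Ea : dist2 a z = r).
  { destruct (Rle_lt_or_eq_dec _ _ (proj1 Hmax)) as [Hlt|]; [|assumption].
    apply Hstrict in Hlt. lra. }
  exists r, a. split; auto. apply Rle_antisym; [apply Hmax | apply Hclosed, Hmax].
Qed.

(** * Orbits that return to a free disc *)

Lemma first_passage (h : R -> R) a b r : (forall t, continuous h t) -> a <= b ->
  r < h a -> h b <= r -> exists M, a <= M <= b /\ h M = r /\ forall t, a <= t < M -> r < h t.
Proof.
  intros Hh Hab Ha Hb.
  set (above := fun t => a <= t <= b /\ forall u, a <= u <= t -> r < h u).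
  assert (above_a : above a) by (split; [lra|]; intros u Hu; now replace u with a by lra).
  destruct (completeness above) as [M [HM_ub HM_lub]].
  { exists b. now intros t [[_ H] _]. }
  { now exists a. }
  assert (HM : a <= M <= b).
  { split; [now apply HM_ub|]. apply HM_lub. now intros t [[_ H] _]. }
  assert (Hbelow : forall t, a <= t < M -> r < h t).
  { intros t Ht. apply NNPP. intros Hno. assert (M <= t); [|lra].
    apply HM_lub. intros u [_ Hu]. apply Rnot_lt_le. intros Htu. apply Hno, Hu. lra. }
  exists M. repeat split; try apply HM; [|exact Hbelow].
  destruct (Rtotal_order (h M) r) as [Hlt|[E|Hgt]]; [exfalso | exact E | exfalso].
  - destruct (Hh M _ (open_lt r _ Hlt)) as [d Hd]. assert (Pd := cond_pos d).
    assert (HaM : a < M) by (destruct (proj1 HM) as [|E]; [assumption | subst; lra]).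
    set (t := Rmax a (M - d / 2)).
    assert (Ht : a <= t < M /\ M - d / 2 <= t) by (unfold t, Rmax; destruct Rle_dec; lra).
    assert (Hrt := Hbelow t (proj1 Ht)).
    assert (Htr : h t < r); [|lra]. apply Hd. change (Rabs (t + - M) < d). apply Rabs_def1; lra.
  - destruct (Hh M _ (open_gt r _ Hgt)) as [d Hd]. assert (Pd := cond_pos d).
    assert (HMb : M < b) by (destruct (proj2 HM) as [|E]; [assumption | subst; lra]).
    set (t := Rmin b (M + d / 2)).
    assert (Ht : M < t <= b /\ t <= M + d / 2) by (unfold t, Rmin; destruct Rle_dec; lra).
    assert (t <= M); [|lra].
    apply HM_ub. split; [lra|]. intros u Hu. destruct (Rlt_le_dec u M); [apply Hbelow; lra|].
    apply Hd. change (Rabs (u + - M) < d). apply Rabs_def1; lra.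
Qed.

Definition concat (t0 : R) (a b : R -> C) (t : R) : C :=
  (a (Rmin t t0) + (b (Rmax t t0) - b t0))%C.

Lemma concat_l t0 a b t : t <= t0 -> concat t0 a b t = a t.
Proof. intros Ht. unfold concat. rewrite Rmin_left, Rmax_right by exact Ht. ring. Qed.

Lemma concat_r t0 a b t : a t0 = b t0 -> t0 <= t -> concat t0 a b t = b t.
Proof. intros E Ht. unfold concat. rewrite Rmin_right, Rmax_left, E by exact Ht. ring. Qed.

Lemma continuous_concat t0 a b : (forall t, continuous a t) -> (forall t, continuous b t) ->
  forall t, continuous (concat t0 a b) t.
Proof.
  intros Ha Hb. apply continuous_of_continuous_on. unfold concat.
  apply continuous_on_Cplus; [|apply continuous_on_Cminus].
  - apply (continuous_on_comp_continuous _ a); auto with continuity.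
  - apply (continuous_on_comp_continuous _ b); auto with continuity.
  - auto with continuity.
Qed.

Lemma orbit_arc_exists (f : C -> C) (arc0 : R -> C) (n : nat) :
  (forall x, continuous f x) -> (forall t, continuous arc0 t) -> arc0 1 = f (arc0 0) ->
  exists arc : R -> C, (forall t, continuous arc t) /\ (forall t, 0 <= t <= 1 -> arc t = arc0 t) /\
    forall t, 0 <= t <= INR n -> arc (t + 1) = f (arc t).
Proof.
  intros Hf H0 H01. induction n as [|n [arc [Harc [Hinit Hstep]]]].
  - exists arc0. repeat split; auto. simpl. intros t Ht. replace t with 0 by lra.
    now rewrite Rplus_0_l.
  - assert (Hglue : arc0 1 = f (arc (1 - 1))) by (rewrite Rminus_diag, Hinit by lra; exact H01).
    exists (concat 1 arc0 (fun t => f (arc (t - 1)))). repeat split.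
    + apply continuous_concat; [exact H0|]. apply continuous_of_continuous_on.
      apply (continuous_on_comp_continuous _ f), (continuous_on_comp_continuous _ arc);
        auto with continuity.
    + intros t Ht. apply concat_l. lra.
    + rewrite S_INR. intros t Ht. rewrite (concat_r 1 _ _ (t + 1)) by (exact Hglue || lra).
      f_equal. replace (t + 1 - 1) with t by ring. destruct (Rle_lt_dec t 1) as [Ht1|Ht1].
      * rewrite concat_l by exact Ht1. apply Hinit. lra.
      * rewrite concat_r by (exact Hglue || lra). rewrite <- Hstep by lra. f_equal. ring.
Qed.

Definition two_radii (a z b : C) : R -> C :=
  concat (1 / 2) (fun t => radial z (1 - 2 * t) a) (fun t => radial z (2 * t - 1) b).

Lemma two_radii_l a z b t : t <= 1 / 2 -> two_radii a z b t = radial z (1 - 2 * t) a.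
Proof. apply concat_l. Qed.

Lemma two_radii_r a z b t : 1 / 2 <= t -> two_radii a z b t = radial z (2 * t - 1) b.
Proof.
  apply concat_r. replace (1 - 2 * (1 / 2)) with 0 by field.
  replace (2 * (1 / 2) - 1) with 0 by field.
  now rewrite !radial_0.
Qed.

Lemma continuous_two_radii a z b t : continuous (two_radii a z b) t.
Proof.
  apply continuous_concat; apply continuous_of_continuous_on; auto with continuity.
Qed.

Lemma dist2_two_radii a z b r t : dist2 a z = r -> dist2 b z = r ->
  dist2 (two_radii a z b t) z = Rabs (1 - 2 * t) * r.
Proof.
  intros Ha Hb. destruct (Rle_lt_dec t (1 / 2)).
  - now rewrite two_radii_l, dist2_radial, Ha.
  - rewrite two_radii_r, dist2_radial, Hb, Rabs_minus_sym by lra. reflexivity.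
Qed.

Lemma two_radii_inj a z b r s t : 0 < r -> dist2 a z = r -> dist2 b z = r -> a <> b ->
  0 <= s -> s < t -> t <= 1 -> two_radii a z b s <> two_radii a z b t.
Proof.
  intros Hr Ha Hb Hab Hs Hst Ht E.
  assert (Er : Rabs (1 - 2 * s) * r = Rabs (1 - 2 * t) * r).
  { rewrite <- !(dist2_two_radii a z b r) by assumption. now rewrite E. }
  apply Rmult_eq_reg_r in Er; [|lra].
  assert (Hsum : t = 1 - s /\ s < 1 / 2).
  { revert Er. unfold Rabs. repeat destruct Rcase_abs; lra. }
  destruct Hsum as [-> Hs2]. apply Hab.
  rewrite two_radii_l, two_radii_r in E by lra.
  replace (2 * (1 - s) - 1) with (1 - 2 * s) in E by ring.
  apply radial_inj in E; [exact E | lra].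
Qed.

Section FirstReturn.

Variables (f : C -> C) (z : C) (r : R) (a : C).
Hypothesis f_continuous : forall x, continuous f x.
Hypothesis f_injective : forall x y, f x = f y -> x = y.
Hypothesis f_orientation : orientation_preserving f.
Hypothesis f_free : forall x, f x <> x.
Hypothesis disc : maximal_free_disc f z r a.

Variables (arc : R -> C) (T : R).
Hypothesis arc_continuous : forall t, continuous arc t.
Hypothesis arc_init : forall t, 0 <= t <= 1 -> arc t = two_radii a z (f a) t.
Hypothesis arc_step : forall t, 0 <= t <= T -> arc (t + 1) = f (arc t).

Lemma dist2_arc_init t : 0 <= t <= 1 -> dist2 (arc t) z = Rabs (1 - 2 * t) * r.
Proof. intros Ht. rewrite arc_init by exact Ht. apply dist2_two_radii; apply disc. Qed.

Lemma arc_init_in_disc t : 0 <= t <= 1 -> dist2 (arc t) z <= r.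
Proof.
  intros Ht. rewrite dist2_arc_init by exact Ht. assert (Hr := disc_radius_gt0 disc).
  assert (Rabs (1 - 2 * t) <= 1) by (apply Rabs_le; lra). nra.
Qed.

Lemma arc_init_in_open_disc t : 0 < t < 1 -> dist2 (arc t) z < r.
Proof.
  intros Ht. rewrite dist2_arc_init by lra. assert (Hr := disc_radius_gt0 disc).
  assert (Rabs (1 - 2 * t) < 1) by (apply Rabs_def1; lra). nra.
Qed.

Lemma arc_leaves_disc t : 1 < t < 2 -> 1 <= T -> r < dist2 (arc t) z.
Proof.
  intros Ht HT. replace t with (t - 1 + 1) by ring. rewrite arc_step by lra.
  apply (disc_open_free disc), arc_init_in_open_disc. lra.
Qed.

Variable M : R.
Hypothesis M_range : 2 <= M <= T + 1.
Hypothesis arc_M : dist2 (arc M) z = r.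
Hypothesis arc_outside : forall t, 1 < t < M -> r < dist2 (arc t) z.

Lemma arc_simple_from_init s t : 0 <= s < 1 -> s < t <= M -> t - s < M -> arc s <> arc t.
Proof.
  intros Hs Hst Hts E. destruct (Rle_lt_dec t 1) as [Ht1|Ht1].
  - rewrite !arc_init in E by lra. revert E.
    apply (two_radii_inj a z (f a) r); try apply disc; try lra. now apply not_eq_sym.
  - assert (Hin := arc_init_in_disc s ltac:(lra)). destruct (Rlt_le_dec t M) as [HtM|HtM].
    + assert (Hout := arc_outside t ltac:(lra)). rewrite E in Hin. lra.
    + assert (Hin' := arc_init_in_open_disc s ltac:(lra)).
      rewrite E in Hin'. replace t with M in Hin' by lra. lra.
Qed.

Lemma arc_simple s t : 0 <= s -> s < t -> t <= M -> t - s < M -> arc s <> arc t.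
Proof.
  assert (Hshift : forall (n : nat) s t, s < INR n + 1 ->
    0 <= s -> s < t -> t <= M -> t - s < M -> arc s <> arc t).
  { clear s t. induction n as [|n IH]; intros s t Hsn Hs Hst Ht Hts.
    - simpl in Hsn. apply arc_simple_from_init; lra.
    - destruct (Rlt_le_dec s 1) as [Hs1|Hs1]; [apply arc_simple_from_init; lra|].
      rewrite S_INR in Hsn. intros E. apply (IH (s - 1) (t - 1)); try lra.
      apply f_injective. rewrite <- !arc_step by lra.
      now replace (s - 1 + 1) with s by ring; replace (t - 1 + 1) with t by ring. }
  destruct (INR_unbounded s) as [n Hn]. apply (Hshift n). lra.
Qed.

Definition return_radius (s : R) : C := radial z (1 - s) (arc M).

Lemma dist2_return_radius s : 0 <= s <= 1 -> dist2 (return_radius s) z = (1 - s) * r.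
Proof. intros Hs. unfold return_radius. rewrite dist2_radial, arc_M, Rabs_pos_eq; lra. Qed.

Lemma return_radius_arc_disjoint s t : 0 <= s <= 1 -> 1 / 2 < t < M -> return_radius s <> arc t.
Proof.
  intros Hs Ht E. assert (Hr := disc_radius_gt0 disc).
  assert (Ed : (1 - s) * r = dist2 (arc t) z) by now rewrite <- dist2_return_radius, E.
  destruct (Rle_lt_dec t 1) as [Ht1|Ht1].
  - rewrite dist2_arc_init, Rabs_minus_sym, Rabs_pos_eq in Ed by lra.
    apply Rmult_eq_reg_r in Ed; [|lra].
    rewrite arc_init, two_radii_r in E by lra. unfold return_radius in E. rewrite Ed in E.
    apply radial_inj in E; [|lra].
    apply (arc_simple 1 M); try lra. rewrite E, arc_init, two_radii_r by lra.
    replace (2 * 1 - 1) with 1 by ring. apply radial_1.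
  - assert (Hout := arc_outside t ltac:(lra)). nra.
Qed.

Lemma return_radius_free s s' : 0 <= s <= 1 -> 0 <= s' <= 1 ->
  f (return_radius s) <> return_radius s'.
Proof.
  intros Hs Hs' E. assert (Hr := disc_radius_gt0 disc).
  assert (Es := dist2_return_radius s Hs). assert (Es' := dist2_return_radius s' Hs').
  destruct (Rle_lt_or_eq_dec 0 s) as [Hs0|<-]; [lra| |].
  - assert (Hout := disc_open_free disc (return_radius s)). rewrite E in Hout. nra.
  - assert (Hout := disc_closed_free disc (return_radius 0)). rewrite E in Hout.
    assert (s' = 0) by nra. subst s'. now apply f_free in E.
Qed.

Lemma first_return_absurd : False.
Proof.
  destruct (closing_path_fixed_point f) with (arc := arc) (M := M) (closing := return_radius)
    (p := 1 / 2) as [x Hx]; [..|now apply (f_free x)]; auto; try lra.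
  - intros t Ht. apply arc_step. lra.
  - exact arc_simple.
  - apply continuous_of_continuous_on. unfold return_radius. auto with continuity.
  - unfold return_radius. rewrite Rminus_0_r. apply radial_1.
  - unfold return_radius. rewrite (arc_init (1 / 2)), two_radii_l, Rminus_diag, radial_0 by lra.
    replace (1 - 2 * (1 / 2)) with 0 by field. now rewrite radial_0.
  - exact return_radius_arc_disjoint.
  - exact return_radius_free.
Qed.

End FirstReturn.

Lemma disc_return_fixed_point (f : C -> C) z r a n :
  (forall x, continuous f x) -> (forall x y, f x = f y -> x = y) -> orientation_preserving f ->
  maximal_free_disc f z r a -> (1 <= n)%nat -> dist2 (Nat.iter n f z) z < r -> exists x, f x = x.
Proof.
  intros Hf Hinj Hop disc Hn Hret. apply NNPP. intros Hno.
  assert (Hfree : forall x, f x <> x) by (intros x E; apply Hno; now exists x).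
  destruct (orbit_arc_exists f (two_radii a z (f a)) n) as [arc [Harc [Hinit Hstep]]]; auto.
  { apply continuous_two_radii. }
  { rewrite two_radii_r, two_radii_l by lra.
    replace (2 * 1 - 1) with 1 by ring. replace (1 - 2 * 0) with 1 by ring. now rewrite !radial_1. }
  assert (Horbit : forall k, (k <= n)%nat -> arc (INR k + 1 / 2) = Nat.iter k f z).
  { induction k as [|k IH]; intros Hk.
    - simpl. rewrite Rplus_0_l, Hinit, two_radii_l by lra.
      replace (1 - 2 * (1 / 2)) with 0 by field. apply radial_0.
    - replace (INR (S k) + 1 / 2) with (INR k + 1 / 2 + 1) by (rewrite S_INR; ring).
      assert (Hkn := le_INR _ _ Hk). rewrite S_INR in Hkn. assert (Hk0 := pos_INR k).
      rewrite Hstep; [now rewrite IH by lia|]. lra. }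
  assert (Hn1 : 1 <= INR n) by exact (le_INR 1 n Hn).
  assert (Hleave := arc_leaves_disc f z r a disc arc (INR n) Hinit Hstep).
  destruct (first_passage (fun t => dist2 (arc t) z) (3 / 2) (INR n + 1 / 2) r)
    as [M [HM [HMr Hout]]].
  - apply continuous_of_continuous_on, continuous_on_dist2; auto with continuity.
    now apply continuous_on_forall.
  - lra.
  - apply Hleave; lra.
  - rewrite Horbit by lia. lra.
  - apply (first_return_absurd f z r a Hf Hinj Hop Hfree disc arc (INR n) Harc Hinit Hstep M); auto.
    + split; [|lra]. apply Rnot_lt_le. intros HM2. assert (H := Hleave M). lra.
    + intros t Ht. destruct (Rlt_le_dec t 2); [apply Hleave | apply Hout]; lra.
Qed.

(** * Fixed point free homeomorphisms have unbounded orbits *)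

Definition nonwandering (f : C -> C) (y : C) : Prop :=
  forall e, 0 < e -> exists x n, (1 <= n)%nat /\ dist2 x y < e /\ dist2 (Nat.iter n f x) y < e.

(* Near the nonwandering point the maximal free discs have radii bounded below. *)
Lemma nonwandering_fixed_point (f g : C -> C) y :
  homeo_with_inv f g -> orientation_preserving f -> nonwandering f y -> exists x, f x = x.
Proof.
  intros [Hf [Hg [Hgf Hfg]]] Hop Hy. apply NNPP. intros Hno.
  assert (Hfree : forall x, f x <> x) by (intros x E; apply Hno; now exists x).
  assert (Hdisc : forall z, exists r a, maximal_free_disc f z r a).
  { intros z. apply (maximal_free_disc_exists f g); auto; now apply cont2_continuous. }
  destruct (Hdisc y) as [r [a disc]]. assert (Hr := disc_radius_gt0 disc).
  destruct (Hy (r / 3)) as [x [n [Hn [Hxy Hny]]]]; [lra|].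
  destruct (Hdisc x) as [r' [a' disc']].
  assert (Hr' : 2 * r / 3 <= r').
  { apply Rnot_lt_le. intros Hlt.
    assert (Ha := disc_point disc'). assert (Hfa := disc_image disc').
    assert (T := dist2_triangle a' x y). assert (T' := dist2_triangle (f a') x y).
    assert (Hout := disc_open_free disc a'). lra. }
  apply Hno, (disc_return_fixed_point f x r' a' n); auto.
  - now apply cont2_continuous.
  - intros u v E. now rewrite <- (Hgf u), <- (Hgf v), E.
  - assert (T := dist2_triangle (Nat.iter n f x) y x). rewrite (dist2_sym y x) in T. lra.
Qed.

Lemma cluster_nonwandering (f : C -> C) (u : nat -> C) y : cluster_point u y ->
  (forall i j, (i < j)%nat -> exists n, (1 <= n)%nat /\
    (Nat.iter n f (u i) = u j \/ Nat.iter n f (u j) = u i)) -> nonwandering f y.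
Proof.
  intros Hy Hu e He.
  assert (Hball : locally y (fun x => dist2 x y < e)).
  { assert (H : continuous (fun x => dist2 x y) y).
    { apply continuous_of_continuous_on. auto with continuity. }
    apply (H (fun t => t < e)), open_lt. now rewrite dist2_refl. }
  destruct (Hy _ 0%nat Hball) as [i [_ Hi]]. destruct (Hy _ (S i) Hball) as [j [Hij Hj]].
  destruct (Hu i j Hij) as [n [Hn [E|E]]].
  - exists (u i), n. now rewrite E.
  - exists (u j), n. now rewrite E.
Qed.

Section Orbits.

Variables f g : C -> C.
Hypothesis f_homeo : homeo_with_inv f g.

Lemma iterZ_of_nat n x : iterZ f g (Z.of_nat n) x = Nat.iter n f x.
Proof. destruct n; [reflexivity|]. simpl. now rewrite SuccNat2Pos.id_succ. Qed.

Lemma iterZ_opp_of_nat n x : iterZ f g (- Z.of_nat n) x = Nat.iter n g x.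
Proof. destruct n; [reflexivity|]. simpl. now rewrite SuccNat2Pos.id_succ. Qed.

Lemma iterZ_succ n x : iterZ f g (n + 1) x = f (iterZ f g n x).
Proof.
  destruct f_homeo as [_ [_ [_ Hfg]]]. destruct (Z_lt_le_dec n 0) as [Hn|Hn].
  - replace (n + 1)%Z with (- Z.of_nat (Z.to_nat (- n - 1)))%Z by lia.
    replace n with (- Z.of_nat (S (Z.to_nat (- n - 1))))%Z at 2 by lia.
    rewrite !iterZ_opp_of_nat. simpl. now rewrite Hfg.
  - replace (n + 1)%Z with (Z.of_nat (S (Z.to_nat n))) by lia.
    replace n with (Z.of_nat (Z.to_nat n)) at 2 by lia.
    now rewrite !iterZ_of_nat.
Qed.

Lemma iterZ_add_nat k n x : iterZ f g (n + Z.of_nat k) x = Nat.iter k f (iterZ f g n x).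
Proof.
  induction k as [|k IH]; [now rewrite Z.add_0_r|].
  replace (n + Z.of_nat (S k))%Z with (n + Z.of_nat k + 1)%Z by lia. now rewrite iterZ_succ, IH.
Qed.

Lemma iter_cancel (h k : C -> C) n x : (forall x, h (k x) = x) -> Nat.iter n h (Nat.iter n k x) = x.
Proof.
  intros H. revert x. induction n as [|n IH]; intros x; [reflexivity|].
  rewrite Nat.iter_succ_r, (Nat.iter_succ n _ k), H. apply IH.
Qed.

Lemma iterZ_opp_cancel n x : iterZ f g (- n) (iterZ f g n x) = x.
Proof.
  destruct f_homeo as [_ [_ [Hgf Hfg]]].
  destruct n as [|n|n]; simpl; [reflexivity | now apply iter_cancel | now apply iter_cancel].
Qed.

Lemma cont2_iter (h : C -> C) n : cont2 h -> cont2 (Nat.iter n h).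
Proof.
  intros Hh. induction n as [|n IH]; intros x e He; [now exists e|].
  destruct (Hh (Nat.iter n h x) e He) as [d [Hd Hdh]].
  destruct (IH x d Hd) as [d' [Hd' Hiter]]. exists d'. split; [exact Hd'|].
  intros y Hy. apply Hdh, Hiter, Hy.
Qed.

Lemma cont2_iterZ n : cont2 (iterZ f g n).
Proof.
  destruct f_homeo as [Hf [Hg _]].
  destruct n as [|n|n]; simpl; [exact (cont2_iter f 0 Hf) | |]; now apply cont2_iter.
Qed.

Hypothesis f_orientation : orientation_preserving f.
Hypothesis f_free : forall x, f x <> x.

Lemma orbit_sequence_unbounded (u : nat -> C) (A : R) :
  (forall i j, (i < j)%nat -> exists n, (1 <= n)%nat /\
    (Nat.iter n f (u i) = u j \/ Nat.iter n f (u j) = u i)) -> exists n, A < Cmod (u n).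
Proof.
  intros Hu. apply NNPP. intros Hno. destruct (bounded_sequence_cluster u A) as [y Hy].
  - intros n. apply Rnot_lt_le. intros H. apply Hno. now exists n.
  - destruct (nonwandering_fixed_point f g y f_homeo f_orientation) as [x Hx].
    + now apply (cluster_nonwandering f u).
    + now apply (f_free x).
Qed.

Lemma forward_orbit_unbounded x A : exists n, (0 <= n)%Z /\ A < Cmod (iterZ f g n x).
Proof.
  destruct (orbit_sequence_unbounded (fun n => iterZ f g (Z.of_nat n) x) A) as [n Hn].
  - intros i j Hij. exists (j - i)%nat. split; [lia|]. left.
    rewrite <- iterZ_add_nat. f_equal. lia.
  - exists (Z.of_nat n). split; [lia | exact Hn].
Qed.

Lemma backward_orbit_unbounded x A : exists n, (n < 0)%Z /\ A < Cmod (iterZ f g n x).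
Proof.
  destruct (orbit_sequence_unbounded (fun n => iterZ f g (- Z.of_nat (S n)) x) A) as [n Hn].
  - intros i j Hij. exists (j - i)%nat. split; [lia|]. right.
    rewrite <- iterZ_add_nat. f_equal. lia.
  - exists (- Z.of_nat (S n))%Z. split; [lia | exact Hn].
Qed.

End Orbits.

(** * Shadowing *)

Lemma finite_positive_lower_bound (eta : nat -> R) (N : nat) : (forall n, 0 < eta n) ->
  exists e, 0 < e /\ forall n, (n < N)%nat -> e <= eta n.
Proof.
  intros Heta. induction N as [|N [e [He Hle]]].
  - exists 1. split; [lra|]. intros n Hn. lia.
  - exists (Rmin e (eta N)). split; [now apply Rmin_glb_lt|]. intros n Hn.
    destruct (Nat.eq_dec n N) as [->|]; [apply Rmin_r|].
    apply Rle_trans with e; [apply Rmin_l | apply Hle; lia].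
Qed.

(* The tolerance is the infimum over [n] of [eta n + dist2 x (P n)]; it is [1]-Lipschitz in [x]. *)
Lemma small_tolerance_exists (P : nat -> C) (eta : nat -> R) :
  (forall n, INR n <= Cmod (P n)) -> (forall n, 0 < eta n) ->
  exists eps, Cplus eps /\ forall n, eps (P n) <= eta n.
Proof.
  intros HP Heta.
  set (below := fun x e => forall n, e <= eta n + dist2 x (P n)).
  assert (Hpos : forall x, exists e, 0 < e /\ below x e).
  { intros x. destruct (INR_unbounded (Cmod x + 1)) as [N HN].
    destruct (finite_positive_lower_bound eta N Heta) as [e [He Hle]].
    exists (Rmin e 1). split; [apply Rmin_glb_lt; lra|]. intros n.
    assert (Hd := dist2_ge0 x (P n)). destruct (le_lt_dec N n) as [Hn|Hn].
    - apply Rle_trans with 1; [apply Rmin_r|]. apply le_INR in Hn.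
      assert (T := Cmod_triangle (P n - x) x). replace (P n - x + x)%C with (P n) in T by ring.
      rewrite <- dist2_Cmod, dist2_sym in T. specialize (HP n). specialize (Heta n). lra.
    - apply Rle_trans with e; [apply Rmin_l|]. specialize (Hle n Hn). lra. }
  assert (Hinf : forall x, exists e, below x e /\ forall e', below x e' -> e' <= e).
  { intros x. destruct (completeness (below x)) as [e [Hub Hlub]].
    - exists (eta 0%nat + dist2 x (P 0%nat)). intros e He. apply He.
    - destruct (Hpos x) as [e [_ He]]. now exists e.
    - exists e. split; [|exact Hub]. intros n. apply Hlub. intros e' He'. apply He'. }
  apply choice in Hinf. destruct Hinf as [eps Heps].
  assert (Hlip : forall x y, eps x - dist2 x y <= eps y).
  { intros x y. apply (Heps y). intros n. assert (H := proj1 (Heps x) n).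
    assert (T := dist2_triangle x y (P n)). lra. }
  exists eps. split; [split|].
  - intros x d Hd. exists d. split; [exact Hd|]. intros y Hy.
    assert (H := Hlip x y). assert (H' := Hlip y x). rewrite dist2_sym in H. apply Rabs_def1; lra.
  - intros x. destruct (Hpos x) as [e [He Hbelow]]. apply Rlt_le_trans with (1 := He).
    now apply (Heps x).
  - intros n. assert (H := proj1 (Heps (P n)) n). rewrite dist2_refl in H. lra.
Qed.

Lemma eq_of_dist2_small x y : (forall j : nat, dist2 x y < / (INR j + 1)) -> x = y.
Proof.
  intros H. apply dist2_eq0, Rle_antisym; [|apply dist2_ge0]. apply Rnot_lt_le. intros Hlt.
  destruct (inv_INR_small _ Hlt) as [N HN].
  specialize (HN N (Nat.le_refl N)). specialize (H N). lra.
Qed.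

(* By continuity of [iterZ f g (- m)], following the orbit of [s i] closely enough at a single time
   [m] confines a point to a prescribed neighbourhood of [s i]; the times are chosen so that the
   points of the orbits concerned escape to infinity. *)
Lemma pinning_tolerance_exists (f g : C -> C) (s : nat -> C) (times : nat -> Z -> Prop) :
  homeo_with_inv f g ->
  (forall i A, exists m, times i m /\ A < Cmod (iterZ f g m (s i))) ->
  exists eps, Cplus eps /\ forall i y,
    (forall m, times i m ->
      dist2 (iterZ f g m y) (iterZ f g m (s i)) < eps (iterZ f g m (s i))) -> y = s i.
Proof.
  intros Hfg Hescape.
  assert (Htimes : forall n, exists me : Z * R, let (i, j) := Cantor.of_nat n in let (m, e) := me in
    times i m /\ INR n <= Cmod (iterZ f g m (s i)) /\ 0 < e /\
    forall y, dist2 (iterZ f g m y) (iterZ f g m (s i)) < e -> dist2 y (s i) < / (INR j + 1)).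
  { intros n. destruct (Cantor.of_nat n) as [i j].
    destruct (Hescape i (INR n)) as [m [Hm Hnorm]].
    destruct (cont2_iterZ f g Hfg (- m) (iterZ f g m (s i)) _ (RinvN_pos j)) as [e [He Hclose]].
    exists (m, e). repeat split; auto; [lra|]. intros y Hy. apply Hclose in Hy.
    now rewrite !(iterZ_opp_cancel f g Hfg) in Hy. }
  apply choice in Htimes. destruct Htimes as [me Hme].
  destruct (small_tolerance_exists
    (fun n => iterZ f g (fst (me n)) (s (fst (Cantor.of_nat n)))) (fun n => snd (me n)))
    as [eps [Heps Hsmall]].
  { intros n. specialize (Hme n). destruct (Cantor.of_nat n), (me n). apply Hme. }
  { intros n. specialize (Hme n). destruct (Cantor.of_nat n), (me n). apply Hme. }
  exists eps. split; [exact Heps|]. intros i y Hy. apply eq_of_dist2_small. intros j.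
  specialize (Hme (Cantor.to_nat (i, j))). specialize (Hsmall (Cantor.to_nat (i, j))).
  rewrite Cantor.cancel_of_to in Hme, Hsmall. destruct (me (Cantor.to_nat (i, j))) as [m e].
  destruct Hme as [Hm [_ [_ Hclose]]]. apply Hclose.
  apply Rlt_le_trans with (2 := Hsmall). now apply Hy.
Qed.

Lemma escaping_orbits_not_shadowed (f g : C -> C) : homeo_with_inv f g ->
  (forall x A, exists n, (0 <= n)%Z /\ A < Cmod (iterZ f g n x)) ->
  (forall x A, exists n, (n < 0)%Z /\ A < Cmod (iterZ f g n x)) ->
  ~ topological_shadowing f g.
Proof.
  intros Hfg Hforward Hbackward Hshadow.
  set (p := RtoC 0). set (q := fun k : nat => RtoC (/ (INR k + 1))).
  destruct (pinning_tolerance_exists f g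
    (fun i => match i with O => p | S k => q k end)
    (fun i m => match i with O => (m < 0)%Z | S _ => (0 <= m)%Z end) Hfg)
    as [eps [Heps Hpin]].
  { intros [|k] A; [apply Hbackward | apply Hforward]. }
  destruct (Hshadow eps Heps) as [delta [[_ Hdelta] Hshadowed]].
  destruct (inv_INR_small (delta p) (Hdelta p)) as [k Hk]. specialize (Hk k (Nat.le_refl k)).
  assert (Hk0 := RinvN_pos k).
  assert (Hjump : dist2 p (q k) = / (INR k + 1)).
  { rewrite dist2_sym, dist2_Cmod. unfold p, q. rewrite <- RtoC_minus, Cmod_R, Rabs_pos_eq; lra. }
  set (xs := fun n : Z => iterZ f g n (if Z_lt_dec n 0 then p else q k)).
  destruct (Hshadowed xs) as [y Hy].
  { intros n. unfold xs at 1 3. rewrite <- (iterZ_succ f g Hfg). unfold xs.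
    destruct (Z.eq_dec n (-1)) as [->|Hn]; [simpl; now rewrite Hjump|].
    destruct (Z_lt_dec n 0), (Z_lt_dec (n + 1) 0); try lia; rewrite dist2_refl; apply Hdelta. }
  assert (Ep : y = p).
  { apply (Hpin 0%nat). intros m Hm. specialize (Hy m). unfold xs in Hy.
    destruct Z_lt_dec in Hy; [exact Hy | lia]. }
  assert (Eq : y = q k).
  { apply (Hpin (S k)). intros m Hm. specialize (Hy m). unfold xs in Hy.
    destruct Z_lt_dec in Hy; [lia | exact Hy]. }
  rewrite <- Ep, <- Eq, dist2_refl in Hjump. lra.
Qed.

Theorem theorem1 (f g : R2 -> R2) :
  homeo_with_inv f g ->
  orientation_preserving f ->
  topological_shadowing f g ->
  exists p : R2, f p = p.
Proof.
  intros Hfg Hop Hshadow. apply NNPP. intros Hno.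
  assert (Hfree : forall x, f x <> x) by (intros x E; apply Hno; now exists x).
  apply (escaping_orbits_not_shadowed f g Hfg).
  - now apply forward_orbit_unbounded.
  - now apply backward_orbit_unbounded.
  - exact Hshadow.
Qed.
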